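(* Let $\Gamma=R_n(2,1)$ be a Rose Window graph with $n\ge3$. Then $\Gamma$ is the underlying graph of a map of class $2_{\{0,1\}}$ if and only if $\gcd(n,6)\ne1$. Moreover, letting $n_0\in\{0,2,3,4,6,8,9,10\}$ be the residue of $n$ modulo $12$: (i) if $n=4$, $\Gamma$ is the underlying graph of exactly one map of class $2_{\{0,1\}}$, with face lengths $4$ and $8$; (ii) if $n_0\in\{3,9\}$, $\Gamma$ is the underlying graph of a unique map of class $2_{\{0,1\}}$, with faces of lengths $4$ and $n$; (iii) if $n_0\in\{4,8\}$ and $n\ne4$, $\Gamma$ is the underlying graph of exactly two nonisomorphic maps of class $2_{\{0,1\}}$: one with faces of lengths $4$ and $n$, the other with faces of lengths $4$ and $2n$; (iv) if $n_0\in\{2,10\}$, $\Gamma$ is the underlying graph of exactly three nonisomorphic maps of class $2_{\{0,1\}}$: one with faces of lengths $4$ and $n$, one with faces of lengths $4$ and $2n$, and one with faces of lengths $n$ and $2n$; (v) if $n_0=0$, $\Gamma$ is the underlying graph of exactly three nonisomorphic maps of class $2_{\{0,1\}}$: two with faces of lengths $4$ and $n$, and one with faces of lengths $4$ and $2n$; (vi) if $n_0=6$, $\Gamma$ is the underlying graph of exactly four nonisomorphic maps of class $2_{\{0,1\}}$: two with faces of lengths $4$ and $n$, one with faces of lengths $4$ and $2n$, and one with faces of lengths $n$ and $2n$.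
   Context: For $n\ge3$, $1\le r\le n-1$ with $r\ne n/2$, and $0\le a\le n-1$, the Rose Window graph $R_n(a,r)$ has vertex set $\{x_i,y_i: i\in\mathbb Z_n\}$ and edges $x_ix_{i+1}$, $y_iy_{i+r}$, $x_iy_i$, $x_iy_{i-a}$ for $i\in\mathbb Z_n$ (indices mod $n$). A map is a $2$-cell embedding of a connected simple graph (its underlying graph) in a closed surface; the components of the complement are the faces, and the length of a face is the length of its boundary walk. All maps considered are polytopal: flags correspond bijectively to incident triples (vertex, edge, face). For a flag $\Phi$ and $i\in\{0,1,2\}$, $\Phi^i$ is the unique flag differing from $\Phi$ exactly in its vertex ($i=0$), edge ($i=1$) or face ($i=2$). $\mathrm{Aut}(\mathcal M)$ is the group of automorphisms of the underlying graph preserving the set of faces. A map is in class $2_{\{0,1\}}$ if $\mathrm{Aut}(\mathcal M)$ has exactly two orbits on flags and for every flag $\Phi$, the flags $\Phi^0,\Phi^1$ lie in the orbit of $\Phi$ while $\Phi^2$ does not. Maps are counted up to map isomorphism. *)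

(* Defs.v *)
From mathcomp Require Import all_boot fingroup perm.
Set Implicit Arguments. Unset Strict Implicit. Unset Printing Implicit Defensive.

(* Vertices: x_i = inl i, y_i = inr i, i in Z_n (represented by 'I_n). *)
Definition rw_vertex (n : nat) : finType := ('I_n + 'I_n)%type.

(* Adjacency of R_n(a,r) (edges x_i x_{i+1}, y_i y_{i+r}, x_i y_i, x_i y_{i-a});
   intended for 0 <= a <= n-1, so (i + n - a) %% n is i - a mod n. *)
Definition rw_adj (n a r : nat) : rel (rw_vertex n) :=
  fun u w =>
    match u, w with
    | inl i, inl j => (val j == (i + 1) %% n) || (val i == (j + 1) %% n)
    | inr i, inr j => (val j == (i + r) %% n) || (val i == (j + r) %% n)
    | inl i, inr j => (val j == val i) || (val j == (i + n - a) %% n)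
    | inr j, inl i => (val j == val i) || (val j == (i + n - a) %% n)
    end.

Arguments rw_adj : clear implicits.

Section Maps.
Variable V : finType.
Variable adj : rel V.

(* An edge is the 2-set {x,y}; a face is represented by its set of boundary
   edges; a map (with underlying graph (V,adj)) by its set of faces. *)
Definition cycle_edges (s : seq V) : {set {set V}} :=
  [set [set x; next s x] | x in s].

Definition is_face (f : {set {set V}}) : Prop :=
  exists s : seq V, [/\ uniq s, 3 <= size s, path.cycle adj s & f = cycle_edges s].

Definition faces_at (M : {set {set {set V}}}) (v : V) : {set {set {set V}}} :=
  [set f in M | [exists e in f, v \in e]].

(* polytopal map with underlying graph (V, adj):
   - every face is bounded by a cycle of the graph,
   - every edge of the graph lies on exactly two faces,
   - around each vertex the faces form a single cycle (connected vertex link),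
     so that gluing the faces yields a closed surface. *)
Definition is_map (M : {set {set {set V}}}) : Prop :=
  [/\ (forall f, f \in M -> is_face f),
      (forall x y, adj x y -> #|[set f in M | [set x; y] \in f]| = 2) &
      (forall v (S : {set {set {set V}}}),
          S \subset faces_at M v -> S != set0 ->
          (forall f g, f \in S -> g \in faces_at M v ->
             (exists e, [/\ e \in f, e \in g & v \in e]) -> g \in S) ->
          S = faces_at M v)].

Definition graph_aut (g : {perm V}) : Prop := forall x y, adj (g x) (g y) = adj x y.

Definition face_img (g : {perm V}) (f : {set {set V}}) : {set {set V}} :=
  [set [set g x | x in e] | e : {set V} in f].

Definition map_img (g : {perm V}) (M : {set {set {set V}}}) : {set {set {set V}}} :=
  [set face_img g f | f in M].

Definition map_aut (M : {set {set {set V}}}) (g : {perm V}) : Prop :=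
  graph_aut g /\ map_img g M = M.

Definition map_iso (M1 M2 : {set {set {set V}}}) : Prop :=
  exists g : {perm V}, graph_aut g /\ map_img g M1 = M2.

Definition flagT := (V * {set V} * {set {set V}})%type.

Definition is_flag (M : {set {set {set V}}}) (p : flagT) : Prop :=
  [/\ p.2 \in M, p.1.2 \in p.2 & p.1.1 \in p.1.2].

Definition flag_act (g : {perm V}) (p : flagT) : flagT :=
  (g p.1.1, [set g x | x in p.1.2], face_img g p.2).

Definition same_orbit (M : {set {set {set V}}}) (p q : flagT) : Prop :=
  exists g, map_aut M g /\ flag_act g p = q.

Definition adj0 (p q : flagT) : Prop := [/\ p.1.1 <> q.1.1, p.1.2 = q.1.2 & p.2 = q.2].
Definition adj1 (p q : flagT) : Prop := [/\ p.1.1 = q.1.1, p.1.2 <> q.1.2 & p.2 = q.2].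
Definition adj2 (p q : flagT) : Prop := [/\ p.1.1 = q.1.1, p.1.2 = q.1.2 & p.2 <> q.2].

Definition class2_01 (M : {set {set {set V}}}) : Prop :=
  [/\ is_map M,
      (exists p1 p2, [/\ is_flag M p1, is_flag M p2, ~ same_orbit M p1 p2 &
          forall q, is_flag M q -> same_orbit M p1 q \/ same_orbit M p2 q]) &
      (forall p q, is_flag M p -> is_flag M q ->
          [/\ adj0 p q -> same_orbit M p q,
              adj1 p q -> same_orbit M p q &
              adj2 p q -> ~ same_orbit M p q])].

Definition face_lengths (M : {set {set {set V}}}) (L : seq nat) : Prop :=
  forall k, (exists2 f, f \in M & #|f| = k) <-> k \in L.

Definition classified (L : seq (seq nat)) : Prop :=
  exists Ms : seq {set {set {set V}}},
    [/\ size Ms = size L,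
        (forall i, i < size Ms ->
            class2_01 (nth set0 Ms i) /\ face_lengths (nth set0 Ms i) (nth [::] L i)),
        (forall i j, i < size Ms -> j < size Ms -> i != j ->
            ~ map_iso (nth set0 Ms i) (nth set0 Ms j)) &
        (forall M, class2_01 M -> exists2 i, i < size Ms & map_iso M (nth set0 Ms i))].

End Maps.

(* Main.v *)
Require Import Defs.
From mathcomp Require Import all_boot fingroup perm all_algebra zify ring.
Set Implicit Arguments. Unset Strict Implicit. Unset Printing Implicit Defensive.
Import GRing.Theory.

(** R_n(2,1) is the lexicographic product C_n[2K_1]: give x_i the level i and y_i the level i+1, so
    that vertices are adjacent iff their levels differ by 1. In a map of class 2_{0,1} the faces fall
    into two colours, each edge lies on one face of either colour, and the automorphism group is
    regular on arcs and preserves colours; a colour is determined by the way its faces turn at the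
    vertices. If automorphisms preserve the pairs of vertices of equal level, each colour either
    consists of all the 4-cycles on two consecutive levels, or has faces which wind around monotonically;
    recording the second coordinate e_k in Z_2 of such a face at level k, one gets
    e_(k+1) = e_(k-1) + s_k(e_k), where s_k(a) = p_k + q a with q constant by transitivity. Simplicity
    of faces and transitivity force e_(k+n) = e_k + t for all solutions, with one t (face length n if t = 0,
    2n if t = 1). Adding solutions of the homogeneous recurrence shows that n is even if q = 0, and that
    3 | n and t = 0 if q = 1. Translation by the sum of a solution for s and one for s' is an isomorphism
    between the corresponding colours as soon as q and t agree, which gives uniqueness, arc-transitivity
    of the models, and excludes two winding colours of the same type t: two winding colours have
    recurrences s and s + 1, so they must be of different types, whence q = 0 and n = 2 mod 4.
    For n <> 4, equal level means equal neighbourhood. For n = 4, counting over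
    the vertices x how often y and y' are paired at x distinguishes one partner y' of each y, because
    3 does not divide 4; this yields an invariant pairing and so another product structure. *)

(** * Faces and colour classes *)

Section Cycles.
Variables (V : finType) (adj : rel V).
Hypothesis adjC : symmetric adj.
Implicit Types (f : {set {set V}}) (s : seq V).

Lemma set2_eq (x y u v : V) :
  [set x; y] = [set u; v] -> (x = u /\ y = v) \/ (x = v /\ y = u).
Proof.
move=> E.
have : x \in [set u; v] by rewrite -E set21.
have : y \in [set u; v] by rewrite -E set22.
have : u \in [set x; y] by rewrite E set21.
have : v \in [set x; y] by rewrite E set22.
by rewrite !inE => /orP[]/eqP-> /orP[]/eqP-> /orP[]/eqP? /orP[]/eqP?; subst; auto.
Qed.

Lemma mem_cycle_edges s u v : uniq s ->
  ([set u; v] \in cycle_edges s) = (u \in s) && ((v == next s u) || (v == prev s u)).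
Proof.
move=> us; apply/imsetP/andP=> [[x xs]|[us' /orP[]/eqP->]].
- case/set2_eq=> [[-> ->]|[-> ->]]; first by rewrite xs eqxx.
  by rewrite mem_next xs prev_next // eqxx orbT.
- by exists u.
- by exists (prev s u); rewrite ?mem_prev // next_prev // setUC.
Qed.

(** Otherwise [next s] would swap [u] and its successor, and the orbit of [u], which is all of [s],
    would have at most two elements. *)
Lemma next_neq_prev s u : uniq s -> 2 < size s -> u \in s -> next s u != prev s u.
Proof.
move=> us ss us'; apply/eqP=> E.
have E2 : next s (next s u) = u by rewrite E next_prev.
have := fconnect_cycle (cycle_next us) us'.
have sub x : fconnect (next s) u x -> x \in [:: u; next s u].
  move=> /iter_findex <-; elim: (findex _ _ _) => [|k IH] /=; first by rewrite inE eqxx.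
  by move: IH; rewrite !inE => /orP[]/eqP->; rewrite ?E2 ?eqxx ?orbT.
move=> H; have /uniq_leq_size : {subset s <= [:: u; next s u]}.
  by move=> x xs; apply: sub; rewrite H.
by move=> /(_ us); rewrite leqNgt ss.
Qed.

(** The boundary is a simple cycle, so exactly two edges of [f] contain [v]. *)
Lemma face_deg f u v : is_face adj f -> [set u; v] \in f ->
  exists w, [/\ w != u, adj v w & forall x, ([set v; x] \in f) = (x == u) || (x == w)].
Proof.
case=> s [us ss cs ->]; rewrite setUC mem_cycle_edges // => /andP[vs H].
have Hn := next_cycle cs vs; have Hp := prev_cycle cs vs.
have D := next_neq_prev us ss vs.
case/orP: H => /eqP->.
- exists (prev s v); split; [by rewrite eq_sym | by rewrite adjC |].
  by move=> x; rewrite mem_cycle_edges // vs.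
- exists (next s v); split=> //.
  by move=> x; rewrite mem_cycle_edges // vs /= orbC.
Qed.

Lemma face_edge f e : is_face adj f -> e \in f -> exists u v, adj u v /\ e = [set u; v].
Proof.
by case=> s [us ss cs ->] /imsetP[x xs ->]; exists x, (next s x); split=> //; apply: next_cycle.
Qed.

(** Induction along the boundary: iterating [next s] from one edge reaches every other edge. *)
Lemma face_conn f (P : {set V} -> Prop) e0 : is_face adj f -> e0 \in f -> P e0 ->
  (forall u v w, [set u; v] \in f -> [set v; w] \in f -> P [set u; v] -> P [set v; w]) ->
  forall e, e \in f -> P e.
Proof.
case=> s [us ss cs ->] /imsetP[x0 x0s ->] P0 H e /imsetP[x xs ->].
have : fconnect (next s) x0 x by rewrite (fconnect_cycle (cycle_next us) x0s).
move=> /iter_findex <-; elim: (findex _ _ _) => [|k IH] //=.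
have ks : iter k (next s) x0 \in s by elim: k {IH} => //= k IH; rewrite mem_next.
by apply: H IH; apply/imsetP; [exists (iter k (next s) x0) | exists (next s (iter k (next s) x0)); rewrite ?mem_next].
Qed.

(* [o v u] is the neighbour of [v] following [u] on the face of [K] through the edge [uv]. *)
Record colour_class (K : {set {set {set V}}}) (o : V -> V -> V) : Prop := ColourClass {
  cc_face : forall f, f \in K -> is_face adj f;
  cc_ex : forall u v, adj u v -> exists2 f, f \in K & [set u; v] \in f;
  cc_uniq : forall u v f f', f \in K -> f' \in K -> [set u; v] \in f -> [set u; v] \in f' -> f = f';
  cc_opp : forall u v f, f \in K -> [set u; v] \in f ->
     forall w, ([set v; w] \in f) = (w == u) || (w == o v u) }.

Lemma face_adj f u v : is_face adj f -> [set u; v] \in f -> adj u v.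
Proof.
move=> Hf /(face_edge Hf)[x [y [xy /set2_eq[[-> ->]|[-> ->]]]]] //; by rewrite adjC.
Qed.

Lemma cc_neq K o u v : colour_class K o -> adj u v -> o v u != u.
Proof.
move=> C /(cc_ex C)[f fK uvf].
have [w [wu _ /(_ w)]] := face_deg (cc_face C fK) uvf.
by rewrite (cc_opp C fK uvf) (negPf wu) eqxx /= => /eqP <-.
Qed.

Lemma cc_adj K o u v : colour_class K o -> adj u v -> adj v (o v u).
Proof.
move=> C /(cc_ex C)[f fK uvf].
have [w [wu aw /(_ w)]] := face_deg (cc_face C fK) uvf.
by rewrite (cc_opp C fK uvf) (negPf wu) eqxx /= => /eqP <-.
Qed.

Lemma cc_invol K o u v : colour_class K o -> adj u v -> o v (o v u) = u.
Proof.
move=> C uv; have [f fK uvf] := cc_ex C uv.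
have vof : [set v; o v u] \in f by rewrite (cc_opp C fK uvf) eqxx orbT.
have : [set v; u] \in f by rewrite setUC.
rewrite setUC in vof; rewrite (cc_opp C fK vof) eq_sym (negPf (cc_neq C uv)) /=.
by move/eqP.
Qed.

(** A face is traced from any one of its edges by the turning function, so the faces of the two
    classes through a common edge coincide. *)
Lemma cc_sub K o K' o' : colour_class K o -> colour_class K' o' ->
  (forall u v, adj u v -> o v u = o' v u) -> K \subset K'.
Proof.
move=> C C' E; apply/subsetP=> f fK.
have Hf := cc_face C fK; have [s [us ss cs fE]] := Hf.
case: s us ss cs fE => // x s us ss cs fE.
have xf : [set x; next (x :: s) x] \in f by rewrite fE; apply/imsetP; exists x; rewrite ?mem_head.
have ax := face_adj Hf xf; have [f' fK' xf'] := cc_ex C' ax.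
have Hf' := cc_face C' fK'.
suff -> : f = f' by [].
apply/setP=> e; apply/idP/idP.
- apply: (face_conn (P := fun e => e \in f') Hf xf xf' _) => u v w uvf vwf uvf'.
  rewrite (cc_opp C' fK' uvf') -E ?(face_adj Hf uvf) //.
  by rewrite -(cc_opp C fK uvf).
- apply: (face_conn (P := fun e => e \in f) Hf' xf' xf _) => u v w uvf' vwf' uvf.
  rewrite (cc_opp C fK uvf) E ?(face_adj Hf uvf) //.
  by rewrite -(cc_opp C' fK' uvf').
Qed.

Lemma cc_ext K o K' o' : colour_class K o -> colour_class K' o' ->
  (forall u v, adj u v -> o v u = o' v u) -> K = K'.
Proof.
move=> C C' E; apply/eqP; rewrite eqEsubset (cc_sub C C') // (cc_sub C' C) // => u v uv.
by rewrite E.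
Qed.

Lemma edge_img (g : {perm V}) u v : [set g x | x in [set u; v]] = [set g u; g v].
Proof. by rewrite imsetU1 imset_set1. Qed.

Lemma edge_img_inj (g : {perm V}) : injective (fun e : {set V} => [set g x | x in e]).
Proof. exact/imset_inj/perm_inj. Qed.

Lemma face_img_inj (g : {perm V}) : injective (face_img g).
Proof. exact/imset_inj/edge_img_inj. Qed.

Lemma mem_face_img (g : {perm V}) f u v :
  ([set g u; g v] \in face_img g f) = ([set u; v] \in f).
Proof. by rewrite -edge_img mem_imset //; apply: edge_img_inj. Qed.

Lemma mem_face_imgV (g : {perm V}) f u v :
  ([set u; v] \in face_img g f) = ([set (g^-1)%g u; (g^-1)%g v] \in f).
Proof. by rewrite -[RHS](mem_face_img g) !permKV. Qed.

Lemma mem_map_img (g : {perm V}) (M : {set {set {set V}}}) f :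
  (face_img g f \in map_img g M) = (f \in M).
Proof. by rewrite mem_imset //; apply: face_img_inj. Qed.

Lemma graph_autV (g : {perm V}) : graph_aut adj g -> graph_aut adj (g^-1)%g.
Proof. by move=> H x y; rewrite -H !permKV. Qed.

Lemma graph_autM (g h : {perm V}) : graph_aut adj g -> graph_aut adj h -> graph_aut adj (g * h)%g.
Proof. by move=> Hg Hh x y; rewrite !permM Hh Hg. Qed.

Lemma face_imgM (g h : {perm V}) f : face_img (g * h)%g f = face_img h (face_img g f).
Proof.
rewrite /face_img -imset_comp; apply: eq_imset => e /=.
by rewrite -imset_comp; apply: eq_imset => x /=; rewrite permM.
Qed.

Lemma face_img1 f : face_img 1%g f = f.
Proof.
rewrite /face_img -[RHS]imset_id; apply: eq_imset => e /=.
by rewrite -[RHS]imset_id; apply: eq_imset => x; rewrite perm1.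
Qed.

Lemma map_imgM (g h : {perm V}) M : map_img (g * h)%g M = map_img h (map_img g M).
Proof.
rewrite /map_img -imset_comp; apply: eq_imset => e /=; exact: face_imgM.
Qed.

Lemma map_img1 (M : {set {set {set V}}}) : map_img 1%g M = M.
Proof. by rewrite /map_img -[RHS]imset_id; apply: eq_imset => e /=; apply: face_img1. Qed.

Lemma map_imgV (g : {perm V}) M M' : map_img g M = M' -> map_img (g^-1)%g M' = M.
Proof. by move=> <-; rewrite -map_imgM mulgV map_img1. Qed.

Lemma map_imgU (g : {perm V}) M M' : map_img g (M :|: M') = map_img g M :|: map_img g M'.
Proof. exact: imsetU. Qed.

Lemma is_face_img (g : {perm V}) f : graph_aut adj g -> is_face adj f -> is_face adj (face_img g f).
Proof.
move=> Hg [s [us ss cs ->]]; exists (map g s); split.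
- by rewrite map_inj_uniq //; apply: perm_inj.
- by rewrite size_map.
- by rewrite cycle_map; apply: sub_cycle cs => x y; rewrite /= Hg.
- apply/setP=> e; apply/imsetP/imsetP.
  + move=> [e' /imsetP[x xs ->] ->]; exists (g x); first by rewrite map_f.
    by rewrite edge_img next_map //; apply: perm_inj.
  + move=> [_ /mapP[x xs ->] ->]; exists [set x; next s x]; first by apply/imsetP; exists x.
    by rewrite edge_img next_map //; apply: perm_inj.
Qed.

Lemma cc_img (g : {perm V}) K o : graph_aut adj g -> colour_class K o ->
  colour_class (map_img g K) (fun v u => g (o ((g^-1)%g v) ((g^-1)%g u))).
Proof.
move=> Hg C; split.
- by move=> _ /imsetP[f fK ->]; apply: is_face_img => //; apply: cc_face C _ _.
- move=> u v uv; have : adj ((g^-1)%g u) ((g^-1)%g v) by rewrite (graph_autV Hg).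
  by case/(cc_ex C) => f fK H; exists (face_img g f); [rewrite mem_map_img | rewrite mem_face_imgV].
- move=> u v _ _ /imsetP[f fK ->] /imsetP[f' fK' ->]; rewrite !mem_face_imgV => H H'.
  by rewrite (cc_uniq C fK fK' H H').
- move=> u v _ /imsetP[f fK ->]; rewrite mem_face_imgV => H w.
  rewrite mem_face_imgV (cc_opp C fK H).
  by rewrite (inj_eq (@perm_inj _ _)) -[w in RHS](permKV g) (inj_eq (@perm_inj _ _)) permKV.
Qed.

(** Reduces every isomorphism between colour classes to an identity on arcs. *)
Lemma cc_iso (g : {perm V}) K o K' o' : graph_aut adj g ->
  colour_class K o -> colour_class K' o' ->
  (forall u v, adj u v -> g (o v u) = o' (g v) (g u)) -> map_img g K = K'.
Proof.
move=> Hg C C' E; apply: (cc_ext (cc_img Hg C) C') => u v uv.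
by rewrite E ?(graph_autV Hg) // !permKV.
Qed.

Lemma cc_equiv (g : {perm V}) K o u v : graph_aut adj g -> colour_class K o -> map_img g K = K ->
  adj u v -> g (o v u) = o (g v) (g u).
Proof.
move=> Hg C gK uv; have [f fK H] := cc_ex C uv.
have H' : [set g u; g v] \in face_img g f by rewrite mem_face_img.
have fK' : face_img g f \in K by rewrite -gK mem_map_img.
have : [set g v; g (o v u)] \in face_img g f.
  by rewrite mem_face_img (cc_opp C fK H) eqxx orbT.
rewrite (cc_opp C fK' H') (inj_eq (@perm_inj _ _)) (negPf (cc_neq C uv)) /=.
by move/eqP.
Qed.

Lemma exists_opp (K : {set {set {set V}}}) :
  (forall f, f \in K -> is_face adj f) ->
  (forall u v, adj u v -> exists2 f, f \in K & [set u; v] \in f) ->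
  (forall u v f f', f \in K -> f' \in K -> [set u; v] \in f -> [set u; v] \in f' -> f = f') ->
  exists o, colour_class K o.
Proof.
move=> H1 H2 H3.
(* The default [u] occurs only where no face of [K] contains uv, hence only for pairs about which
   [cc_opp] says nothing. *)
pose o v u := odflt u [pick w | (w != u) && [exists f in K, ([set u; v] \in f) && ([set v; w] \in f)]].
exists o; split=> // u v f fK H w.
have [w' [wu aw Hw]] := face_deg (H1 f fK) H.
rewrite Hw; suff -> : o v u = w' by [].
rewrite /o; case: pickP => [x /andP[xu /existsP[f' /and3P[fK' A B]]]|].
- by move: B; rewrite (H3 _ _ _ _ fK' fK A H) Hw (negPf xu) /= => /eqP.
- move=> /(_ w'); rewrite wu /= => /existsP[].
  by exists f; rewrite fK H Hw eqxx orbT.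
Qed.

End Cycles.

(** * Maps of class 2_{0,1} and their two colours *)

Section Decomposition.
Variables (V : finType) (adj : rel V).
Hypothesis adjC : symmetric adj.
Hypothesis adjI : irreflexive adj.
Implicit Types (M : {set {set {set V}}}).

(** The local content of a map of class 2_{0,1}. Each arc determines one flag of either colour, so
    transitivity on the flags of one colour is transitivity on arcs. [tc_neq] stands for
    connectedness of the vertex links: on four neighbours, two fixed-point-free involutions generate
    a transitive group as soon as they differ. *)
Record two_colouring K1 K2 (o1 o2 : V -> V -> V) : Prop := TwoColouring {
  tc_cc1 : colour_class adj K1 o1;
  tc_cc2 : colour_class adj K2 o2;
  tc_trans : forall u v u' v', adj u v -> adj u' v' -> exists g : {perm V},
    [/\ graph_aut adj g, g u = u', g v = v', map_img g K1 = K1 & map_img g K2 = K2];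
  tc_neq : forall u v, adj u v -> o1 v u <> o2 v u }.

Lemma two_colouringC K1 K2 o1 o2 : two_colouring K1 K2 o1 o2 -> two_colouring K2 K1 o2 o1.
Proof.
case=> C1 C2 T N; split=> // [u v u' v' a a'|u v a E]; last by apply: (N u v).
by have [g [? ? ? ? ?]] := T _ _ _ _ a a'; exists g.
Qed.

Section Orbit.
Variable M : {set {set {set V}}}.

Lemma map_aut1 : map_aut adj M 1%g.
Proof. by split; [move=> x y; rewrite !perm1 | apply: map_img1]. Qed.

Lemma map_autM g h : map_aut adj M g -> map_aut adj M h -> map_aut adj M (g * h)%g.
Proof.
by move=> [Hg Mg] [Hh Mh]; split; [apply: graph_autM | rewrite map_imgM Mg Mh].
Qed.

Lemma map_autV g : map_aut adj M g -> map_aut adj M (g^-1)%g.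
Proof. by move=> [Hg Mg]; split; [apply: graph_autV | apply: map_imgV]. Qed.

Lemma flag_actM (g h : {perm V}) p : flag_act (g * h)%g p = flag_act h (flag_act g p).
Proof.
case: p => [[x e] f]; rewrite /flag_act /= permM face_imgM; congr (_, _, _).
by rewrite -imset_comp; apply: eq_imset => y /=; rewrite permM.
Qed.

Lemma flag_act1 (p : flagT V) : flag_act 1%g p = p.
Proof.
case: p => [[x e] f]; rewrite /flag_act /= perm1 face_img1; congr (_, _, _).
by rewrite -[RHS]imset_id; apply: eq_imset => y; rewrite perm1.
Qed.

Lemma same_orbit_refl p : same_orbit adj M p p.
Proof. by exists 1%g; split; [apply: map_aut1 | apply: flag_act1]. Qed.

Lemma same_orbit_sym p q : same_orbit adj M p q -> same_orbit adj M q p.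
Proof.
case=> g [Hg <-]; exists (g^-1)%g; split; first exact: map_autV.
by rewrite -flag_actM mulgV flag_act1.
Qed.

Lemma same_orbit_trans p q r :
  same_orbit adj M p q -> same_orbit adj M q r -> same_orbit adj M p r.
Proof.
case=> g [Hg <-] [h [Hh <-]]; exists (g * h)%g; split; first exact: map_autM.
exact: flag_actM.
Qed.

(** A boolean form of [same_orbit], so that the faces of one orbit can be collected in a finite
    set. *)
Definition same_orbitb p q := [exists g : {perm V},
  [&& [forall x, forall y, adj (g x) (g y) == adj x y], map_img g M == M & flag_act g p == q]].

Lemma same_orbitP p q : reflect (same_orbit adj M p q) (same_orbitb p q).
Proof.
apply: (iffP existsP) => [[g /and3P[/forallP H /eqP ? /eqP ?]]|[g [[H /eqP ?] /eqP ?]]]; exists g.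
- by split=> //; split=> // x y; move/forallP: (H x) => /(_ y)/eqP.
- by apply/and3P; split=> //; apply/forallP=> x; apply/forallP => y; apply/eqP.
Qed.

Lemma is_flag_act g p : map_aut adj M g -> is_flag M p -> is_flag M (flag_act g p).
Proof.
move=> [Hg Mg] [/= H1 H2 H3]; split=> /=.
- by rewrite -Mg mem_map_img.
- exact: imset_f.
- exact: imset_f.
Qed.

End Orbit.

Definition no_swap (K1 K2 : {set {set {set V}}}) := forall g : {perm V}, graph_aut adj g ->
  map_img g K1 = K2 -> map_img g K2 = K1 -> False.

Lemma imset_stable_eq (T : finType) (h : T -> T) (A : {set T}) :
  injective h -> {in A, forall x, h x \in A} -> h @: A = A.
Proof.
move=> hi H; apply/eqP; rewrite eqEcard card_imset // leqnn andbT.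
by apply/subsetP=> _ /imsetP[x xA ->]; apply: H.
Qed.

Hypothesis third_nbr : forall v u w, exists2 x, adj v x & (x != u) && (x != w).

(** [K1] collects the faces with a flag in the orbit of [p1]. All flags of a face lie in one orbit,
    because the moves to Phi^0 and Phi^1 stay in the orbit; the two faces on an edge have different
    colours, because the move to Phi^2 leaves it. *)
Theorem class2_two_colouring M : class2_01 adj M ->
  exists K1 K2 o1 o2, [/\ M = K1 :|: K2, two_colouring K1 K2 o1 o2 & no_swap K1 K2].
Proof.
case=> [[Mf Me Ml] [p1 [p2 [fl1 fl2 n12 orb]]] Hadj].
pose K1 := [set f in M | [exists e : {set V}, exists x,
   [&& e \in f, x \in e & same_orbitb M p1 (x, e, f)]]].
pose K2 := M :\: K1.
have K1M f : f \in K1 -> f \in M by rewrite inE => /andP[].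
have K2M f : f \in K2 -> f \in M by rewrite inE => /andP[].
have noloop f x y : f \in M -> [set x; y] \in f -> x <> y.
  by move=> /Mf Hf /(face_adj adjC Hf) + E; rewrite E adjI.
have inK1 q : is_flag M q -> (q.2 \in K1) <-> same_orbit adj M p1 q.
  case: q => [[x e] f] [/= fM ef xe]; split; last first.
    move=> H; rewrite inE fM; apply/existsP; exists e; apply/existsP; exists x.
    by rewrite ef xe /=; apply/same_orbitP.
  rewrite inE fM => /existsP[e0 /existsP[x0 /and3P[ef0 xe0 /same_orbitP H0]]].
  have Hf := Mf _ fM.
  pose P (e : {set V}) := forall x, x \in e -> same_orbit adj M p1 (x, e, f).
  have Pex e1 x1 : e1 \in f -> x1 \in e1 -> same_orbit adj M p1 (x1, e1, f) -> P e1.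
    move=> ef1 xe1 H1 y ye1; case: (eqVneq x1 y) => [<- //|xy].
    apply: same_orbit_trans H1 _.
    by have [] := Hadj (x1, e1, f) (y, e1, f) => // + _ _; apply; split=> //=; apply/eqP.
  apply: (@face_conn _ _ _ P e0 Hf ef0 _ _ e ef x xe); first exact: Pex H0.
  move=> u v w uvf vwf Puv.
  apply: (Pex _ v); rewrite ?set21 //.
  case: (eqVneq [set u; v] [set v; w]) => [<-|D]; first by apply: Puv; rewrite set22.
  apply: same_orbit_trans (Puv v _) _; rewrite ?set22 //.
  have [] := Hadj (v, [set u; v], f) (v, [set v; w], f); try by split; rewrite //= ?set22 ?set21.
  by move=> _ + _; apply; split=> //=; apply/eqP.
have inK2 q : is_flag M q -> (q.2 \in K2) <-> same_orbit adj M p2 q.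
  move=> fq; have qM : q.2 \in M by case: fq.
  rewrite inE qM andbT; split.
  - by move/negP=> H; case: (orb q fq) => // /(inK1 _ fq).
  - move=> H2; apply/negP => /(inK1 _ fq) H1; apply: n12.
    exact: same_orbit_trans H1 (same_orbit_sym H2).
have same1 q r : is_flag M q -> is_flag M r -> q.2 \in K1 -> r.2 \in K1 -> same_orbit adj M q r.
  move=> fq fr /(inK1 _ fq) H /(inK1 _ fr); apply: same_orbit_trans; exact: same_orbit_sym.
have same2 q r : is_flag M q -> is_flag M r -> q.2 \in K2 -> r.2 \in K2 -> same_orbit adj M q r.
  move=> fq fr /(inK2 _ fq) H /(inK2 _ fr); apply: same_orbit_trans; exact: same_orbit_sym.
have not2 u v f f' : f \in M -> f' \in M -> [set u; v] \in f -> [set u; v] \in f' -> f <> f' ->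
    ~ same_orbit adj M (u, [set u; v], f) (u, [set u; v], f').
  move=> fM fM' ef ef' D.
  have [] := Hadj (u, [set u; v], f) (u, [set u; v], f'); try by split; rewrite //= set21.
  by move=> _ _; apply.
have uniq1 u v f f' : f \in K1 -> f' \in K1 -> [set u; v] \in f -> [set u; v] \in f' -> f = f'.
  move=> fK fK' ef ef'; apply/eqP; apply: contraT => /eqP D.
  case: (not2 u v f f' (K1M _ fK) (K1M _ fK') ef ef' D).
  by apply: same1 => //; split; rewrite /= ?set21 ?K1M.
have uniq2 u v f f' : f \in K2 -> f' \in K2 -> [set u; v] \in f -> [set u; v] \in f' -> f = f'.
  move=> fK fK' ef ef'; apply/eqP; apply: contraT => /eqP D.
  case: (not2 u v f f' (K2M _ fK) (K2M _ fK') ef ef' D).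
  by apply: same2 => //; split; rewrite /= ?set21 ?K2M.
have exf u v : adj u v -> exists f f', [/\ f \in K1, f' \in K2, [set u; v] \in f & [set u; v] \in f'].
  move=> uv; have /cards2P[f [f' [D E]]] : #|[set f in M | [set u; v] \in f]| == 2 by apply/eqP; apply: Me.
  have : f \in [set f in M | [set u; v] \in f] by rewrite E set21.
  have : f' \in [set f in M | [set u; v] \in f] by rewrite E set22.
  rewrite !inE => /andP[fM' ef'] /andP[fM ef].
  case: (boolP (f \in K1)) => fK1; case: (boolP (f' \in K1)) => fK1'.
  - by rewrite (uniq1 _ _ _ _ fK1 fK1' ef ef') eqxx in D.
  - by exists f, f'; split=> //; rewrite inE fK1'.
  - by exists f', f; split=> //; rewrite inE fK1.
  - have fK2 : f \in K2 by rewrite inE fK1.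
    have fK2' : f' \in K2 by rewrite inE fK1'.
    by rewrite (uniq2 _ _ _ _ fK2 fK2' ef ef') eqxx in D.
have [o1 C1] : exists o, colour_class adj K1 o.
  apply: exists_opp => // [f /K1M/Mf //|u v /exf[f [f' [? ? ? ?]]]]; by exists f.
have [o2 C2] : exists o, colour_class adj K2 o.
  apply: exists_opp => // [f /K2M/Mf //|u v /exf[f [f' [? ? ? ?]]]]; by exists f'.
have MK : M = K1 :|: K2.
  by apply/setP=> f; rewrite !inE; case: (f \in M) => //=; case: [exists _, _].
have flagof f : f \in M -> exists x e, is_flag M (x, e, f).
  move=> fM; have [s [us ss cs fE]] := Mf _ fM.
  case: s us ss cs fE => // x s us ss cs fE; exists x, [set x; next (x :: s) x].
  split; rewrite /= ?set21 // fE; apply/imsetP; exists x => //; exact: mem_head.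
have stab g : map_aut adj M g -> map_img g K1 = K1 /\ map_img g K2 = K2.
  move=> Hg; split; apply: imset_stable_eq; try exact: face_img_inj.
  - move=> f fK; have [x [e fl]] := flagof f (K1M _ fK).
    have fl' := is_flag_act Hg fl.
    have /(inK1 _ fl) H : (x,e,f).2 \in K1 by [].
    have /(inK1 _ fl') // : same_orbit adj M p1 (flag_act g (x, e, f)).
    apply: same_orbit_trans H _; by exists g.
  - move=> f fK; have [x [e fl]] := flagof f (K2M _ fK).
    have fl' := is_flag_act Hg fl.
    have /(inK2 _ fl) H : (x,e,f).2 \in K2 by [].
    have /(inK2 _ fl') // : same_orbit adj M p2 (flag_act g (x, e, f)).
    apply: same_orbit_trans H _; by exists g.
exists K1, K2, o1, o2; split=> //.
- split=> //.
  (* Transitivity on the flags of the first colour, applied to the flags at u and u'; since u goes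
     to u' and uv to u'v', v goes to v'. *)
  + move=> u v u' v' uv uv'.
    have [f [_ [fK _ ef _]]] := exf _ _ uv; have [f' [_ [fK' _ ef' _]]] := exf _ _ uv'.
    have [g [Hg [E1 E2 E3]]] : same_orbit adj M (u, [set u; v], f) (u', [set u'; v'], f').
      by apply: same1 => //; split; rewrite /= ?set21 ?K1M.
    exists g; have [S1 S2] := stab g Hg; split=> //; first by case: Hg.
    move: E2; rewrite edge_img => /set2_eq[[_ ->] //|[gu gv]].
    have : g u <> g v by move/perm_inj => E; move: uv; rewrite E adjI.
    by rewrite gv E1.
  (* If the colours turn alike at this arc, the two faces through uv share both of their edges at v.
     They are then closed under adjacency at v, hence are all the faces there, and a third edge at v
     lies on neither. *)
  + move=> u v uv E.
    have [f1 [f2 [fK1 fK2 ef1 ef2]]] := exf _ _ uv.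
    have S1 : [set f1; f2] \subset faces_at M v.
      apply/subsetP=> f; rewrite !inE => /orP[]/eqP->; rewrite (K1M _ fK1, K2M _ fK2) /=;
      by apply/existsP; exists [set u; v]; rewrite ?ef1 ?ef2 set22.
    have : [set f1; f2] = faces_at M v.
      apply: Ml => //; first by apply/set0Pn; exists f1; rewrite set21.
      move=> f g Hf; rewrite inE => /andP[gM _] [e [ef eg ve]].
      have fM : f \in M by move: Hf; rewrite !inE => /orP[]/eqP->; [apply: K1M | apply: K2M].
      have [x Ex] : exists x, e = [set v; x].
        have [a [b [_ ab]]] := face_edge (Mf _ fM) ef.
        by move: ve; rewrite ab !inE => /orP[]/eqP->; [exists b | exists a; rewrite setUC].
      rewrite {}Ex in ef eg ve.
      have : (x == u) || (x == o1 v u).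
        move: Hf ef; rewrite !inE => /orP[]/eqP->; first by rewrite (cc_opp C1 fK1 ef1).
        by rewrite (cc_opp C2 fK2 ef2) E.
      move=> Hx.
      have xf1 : [set v; x] \in f1 by rewrite (cc_opp C1 fK1 ef1).
      have xf2 : [set v; x] \in f2 by rewrite (cc_opp C2 fK2 ef2) -E.
      have : g \in K1 :|: K2 by rewrite -MK.
      case/setUP=> gK.
      * by rewrite (uniq1 _ _ _ _ gK fK1 eg xf1) set21.
      * by rewrite (uniq2 _ _ _ _ gK fK2 eg xf2) set22.
    have [x vx /andP[xu xo]] := third_nbr v u (o1 v u).
    have [f3 [_ [fK3 _ ef3 _]]] := exf _ _ vx.
    move=> /setP/(_ f3); rewrite !inE (K1M _ fK3) /=.
    have -> : [exists e in f3, v \in e] by apply/existsP; exists [set v; x]; rewrite ef3 set21.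
    case/orP=> /eqP E3.
    * by move: ef3; rewrite E3 (cc_opp C1 fK1 ef1) (negPf xu) (negPf xo).
    * by move: fK2; rewrite inE -E3 fK3.
(* A permutation exchanging the colours would be an automorphism of the map, and those preserve each
   colour. *)
- move=> g Hg E1 E2.
  have Hga : map_aut adj M g by split=> //; rewrite MK map_imgU E1 E2 setUC.
  case: (stab g Hga) => E3 _.
  have [pM _ _] := fl1.
  have : p1.2 \in K1 by apply/(inK1 _ fl1); apply: same_orbit_refl.
  move=> H; have : p1.2 \in K2 by rewrite -E1 E3.
  by rewrite inE H.
Qed.

End Decomposition.

(** * From two-colourings back to maps of class 2_{0,1} *)

Section Converse.
Variables (V : finType) (adj : rel V).
Hypothesis adjC : symmetric adj.
Hypothesis deg4 : forall v, #|[set u | adj v u]| = 4.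
Implicit Types (M K : {set {set {set V}}}).

Lemma deg4_third v u w : exists2 x, adj v x & (x != u) && (x != w).
Proof.
have : ~~ ([set x | adj v x] \subset [set u; w]).
  apply/negP => /subset_leq_card; rewrite deg4 cards2.
  by case: (u != w).
by case/subsetPn=> x; rewrite !inE negb_or => vx H; exists x.
Qed.

Lemma face_edge_at f (e : {set V}) v : is_face adj f -> e \in f -> v \in e ->
  exists2 x, adj v x & e = [set x; v].
Proof.
move=> Hf ef ve; have [a [b [ab E]]] := face_edge Hf ef.
move: ve; rewrite E !inE => /orP[]/eqP->; last by exists a; rewrite // adjC.
by exists b; rewrite // setUC.
Qed.

Lemma card_face_img (g : {perm V}) f : #|face_img g f| = #|f|.
Proof. exact/card_imset/edge_img_inj. Qed.

(** A flag of the first colour is an arc together with the only face of [K1] on it, so transitivity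
    on arcs carries over to these flags. *)
Lemma same_orbit_colour M K1 K2 o1 o2 p q : M = K1 :|: K2 -> two_colouring adj K1 K2 o1 o2 ->
  is_flag M p -> is_flag M q -> p.2 \in K1 -> q.2 \in K1 -> same_orbit adj M p q.
Proof.
move=> MK [C1 C2 T N]; case: p => [[x e] f]; case: q => [[x' e'] f'] [/= _ ef xe] [/= _ ef' xe'] fK fK'.
have [y xy Ey] := face_edge_at (cc_face C1 fK) ef xe; have [y' xy' Ey'] := face_edge_at (cc_face C1 fK') ef' xe'.
rewrite setUC in Ey; rewrite setUC in Ey'.
have [g [Hg gx gy gK1 gK2]] := T _ _ _ _ xy xy'.
exists g; split; first by split=> //; rewrite MK map_imgU gK1 gK2.
rewrite /flag_act /= gx Ey edge_img gx gy -Ey'; congr (_, _, _).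
have fgK : face_img g f \in K1 by rewrite -gK1 mem_map_img.
apply: (cc_uniq C1 fgK fK' (u := x') (v := y')); last by rewrite -Ey'.
by rewrite -gx -gy mem_face_img -Ey.
Qed.

(** The different face lengths guarantee that no automorphism takes a face of one colour to a face
    of the other, so Phi^2 is never in the orbit of Phi. *)
Theorem two_colouring_class2 K1 K2 o1 o2 l1 l2 (v0 : V) : two_colouring adj K1 K2 o1 o2 ->
  (forall f, f \in K1 -> #|f| = l1) -> (forall f, f \in K2 -> #|f| = l2) -> l1 != l2 ->
  class2_01 adj (K1 :|: K2).
Proof.
move=> TC L1 L2 D.
have TC' := two_colouringC TC; have [C1 C2 T N] := TC.
set M := _ :|: _.
have disj f : f \in K1 -> f \in K2 -> False.
  by move=> /L1 E1 /L2 E2; move: D; rewrite -E1 -E2 eqxx.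
have MC : M = K2 :|: K1 by rewrite /M setUC.
have orbN p q : p.2 \in K1 -> q.2 \in K2 -> ~ same_orbit adj M p q.
  move=> pK qK [g [_ E]]; move: D.
  by rewrite -(L1 _ pK) -(L2 _ qK) -E /= card_face_img eqxx.
have [u0 vu0 _] := deg4_third v0 v0 v0.
have [f1 fK1 ef1] := cc_ex C1 vu0; have [f2 fK2 ef2] := cc_ex C2 vu0.
have fl1 : is_flag M (v0, [set v0; u0], f1) by split; rewrite //= ?set21 // inE fK1.
have fl2 : is_flag M (v0, [set v0; u0], f2) by split; rewrite //= ?set21 // inE fK2 orbT.
split.
- split.
  + by move=> f /setUP[]; [apply: cc_face C1 _ | apply: cc_face C2 _].
  + move=> x y xy.
    have [f fK ef] := cc_ex C1 xy; have [f' fK' ef'] := cc_ex C2 xy.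
    suff -> : [set h in M | [set x; y] \in h] = [set f; f'].
      by rewrite cards2; case: eqP => // E; case: (disj f) => //; rewrite E.
    apply/setP=> h; rewrite inE; apply/andP/set2P.
    * case=> /setUP[hK|hK] eh; first by left; apply: (cc_uniq C1 hK fK eh ef).
      by right; apply: (cc_uniq C2 hK fK' eh ef').
    * by case=> ->; rewrite ?ef ?ef' inE ?fK ?fK' ?orbT.
  + move=> v S /subsetP SM /set0Pn[f fS] Scl.
    (* The neighbours u of v whose edge to v lies on a face of [S]. They are closed under [o1 v] and
       [o2 v]. *)
    pose covered u := exists f, [/\ f \in S, adj v u & [set u; v] \in f].
    have step u : covered u -> covered (o1 v u) /\ covered (o2 v u).
      case=> h [hS vu uvh].
      have uv : adj u v by rewrite adjC.
      have inS K o : colour_class adj K o -> {subset K <= M} -> covered (o v u).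
        move=> C KM; have [h' hK' ef'] := cc_ex C uv.
        have vo : [set v; o v u] \in h' by rewrite (cc_opp C hK' ef') eqxx orbT.
        exists h'; split; last by rewrite setUC.
        - apply: (Scl h h' hS); last by exists [set u; v]; rewrite set22.
          rewrite inE KM //=; apply/existsP; exists [set u; v]; by rewrite ef' set22.
        - exact: (cc_adj adjC C uv).
      by split; [apply: (inS _ _ C1) | apply: (inS _ _ C2)] => x xK; rewrite inE xK ?orbT.
    have [u Hu] : exists u, covered u.
      move: (SM _ fS); rewrite inE => /andP[fM /existsP[e /andP[ef ve]]].
      have Hf : is_face adj f by case/setUP: fM; [apply: cc_face C1 _ | apply: cc_face C2 _].
      by have [x vx Ex] := face_edge_at Hf ef ve; exists x, f; rewrite -Ex.
    have [H1 H2] := step _ Hu; have [_ H3] := step _ H1.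
    have vu : adj u v by case: Hu => ? []; rewrite adjC.
    have vo : adj (o1 v u) v by rewrite adjC (cc_adj adjC C1).
    have n1 := cc_neq adjC C1 vu; have n2 := cc_neq adjC C2 vu.
    have n3 := cc_neq adjC C2 vo.
    have n4 : o2 v (o1 v u) != o2 v u.
      by apply/eqP => /(congr1 (o2 v)); rewrite !(cc_invol adjC C2) //; apply/eqP.
    have n5 : o2 v (o1 v u) != u.
      apply/eqP => /(congr1 (o2 v)); rewrite (cc_invol adjC C2) //; exact: N.
    have n6 : o1 v u != o2 v u by apply/eqP; apply: N.
    (* The four covered vertices u, [o1 v u], [o2 v u], [o2 v (o1 v u)] are distinct neighbours of
       v, hence all of them, the degree being 4. *)
    have cov x : adj v x -> covered x.
      have -> : adj v x = (x \in [set x | adj v x]) by rewrite inE.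
      suff <- : [set u; o1 v u; o2 v u; o2 v (o1 v u)] = [set x | adj v x].
        by rewrite !inE -!orbA => /or4P[]/eqP->.
      apply/eqP; rewrite eqEcard deg4; apply/andP; split.
        apply/subsetP=> y; rewrite !inE -!orbA => /or4P[]/eqP->.
        - by rewrite adjC.
        - exact: (cc_adj adjC C1 vu).
        - exact: (cc_adj adjC C2 vu).
        - exact: (cc_adj adjC C2 vo).
      rewrite -!setUA !cardsU1 !inE cards1 !negb_or (eq_sym u) n1 (eq_sym u) n2 (eq_sym u) n5.
      by rewrite n6 (eq_sym _ (o2 v (o1 v u))) n3 (eq_sym (o2 v u)) n4.
    apply/eqP; rewrite eqEsubset; apply/andP; split; first exact/subsetP.
    apply/subsetP=> g Hg; move: (Hg); rewrite inE => /andP[gM /existsP[e /andP[eg ve]]].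
    have Hf : is_face adj g by case/setUP: gM; [apply: cc_face C1 _ | apply: cc_face C2 _].
    have [x vx Ex] := face_edge_at Hf eg ve.
    have [h [hS _ eh]] := cov _ vx.
    by apply: (Scl h g hS Hg); exists e; rewrite eg ve Ex.
- exists (v0, [set v0; u0], f1), (v0, [set v0; u0], f2); split=> //; first exact: orbN.
  move=> q fq; have [qM _ _] := fq; case/setUP: qM => qK.
  + by left; apply: same_orbit_colour TC _ _ _ _.
  + by right; apply: same_orbit_colour MC TC' _ _ _ _.
- move=> p q fp fq.
  have same : p.2 = q.2 -> same_orbit adj M p q.
    move=> E; have [pM _ _] := fp; case/setUP: pM => pK.
    + by apply: same_orbit_colour TC _ _ _ _ => //; rewrite -E.
    + by apply: same_orbit_colour MC TC' _ _ _ _ => //; rewrite -E.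
  split; [by case=> _ _ /same | by case=> _ _ /same | case=> _ E1 E2].
  have [pM ep _] := fp; have [qM eq _] := fq.
  case/setUP: pM => pK; case/setUP: qM => qK.
  + case: E2; have [a [b [ab E]]] := face_edge (cc_face C1 pK) ep.
    by apply: (cc_uniq C1 pK qK (u := a) (v := b)); rewrite -E // E1.
  + exact: orbN.
  + move/same_orbit_sym; exact: orbN.
  + case: E2; have [a [b [ab E]]] := face_edge (cc_face C2 pK) ep.
    by apply: (cc_uniq C2 pK qK (u := a) (v := b)); rewrite -E // E1.
Qed.

End Converse.

(** * Recurrences over Z/2 *)

Section Parity.
Local Open Scope ring_scope.
Implicit Types k : int.

(** Special solutions of c_(k+1) = c_(k-1) + p + q c_k over Z/2: the parity of k for p = q = 0, the
    parity of the floor of k/2 for p = 1 and q = 0, and non-divisibility by 3 for p = 0 and q =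
    1. *)
Lemma odd_absS k : odd `|k + 1| = ~~ odd `|k|. Proof. lia. Qed.
Lemma odd_absP k : odd `|k - 1| = ~~ odd `|k|. Proof. lia. Qed.
Lemma odd_half_step k : odd `|((k + 1) %/ 2)%Z| = ~~ odd `|((k - 1) %/ 2)%Z|. Proof. lia. Qed.
Lemma odd_half_shift k (p : nat) : ~~ odd p ->
  odd `|((k + p%:Z) %/ 2)%Z| = odd `|(k %/ 2)%Z| (+) odd p./2.
Proof. lia. Qed.
Lemma mod3_step k :
  (((k + 1) %% 3)%Z != 0) = (((k - 1) %% 3)%Z != 0) (+) ((k %% 3)%Z != 0).
Proof. lia. Qed.

End Parity.

Section Sequences.
Variable m : nat.
Local Notation n := m.+3.
Local Notation "k %:m" := ((k%:~R)%R : 'I_n) (at level 2, format "k %:m").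
Implicit Types (k : int) (i : 'I_n) (s : 'I_n -> bool -> bool) (e : int -> bool).
Local Open Scope ring_scope.

Lemma castD k k' : (k + k')%:m = k%:m + k'%:m.
Proof. exact: intrD. Qed.

Lemma cast_nat i : (i : nat)%:Z%:m = i.
Proof. exact: natr_Zp. Qed.

Lemma cast_n : n%:Z%:m = 0.
Proof. by change (n%:R = 0 :> 'I_n); rewrite Zp_nat; apply/val_inj; rewrite /= modnn. Qed.

Lemma cast0P k : (k%:m = 0) <-> exists j : int, k = j * n%:Z.
Proof.
split=> [H|[j ->]]; last by rewrite intrM -[n%:Z%:~R]/(n%:Z%:m) cast_n mulr0.
have nat0 (p : nat) : (p%:Z%:m = 0) -> exists j : int, p%:Z = j * n%:Z.
  change (p%:R = 0 :> 'I_n -> exists j : int, p%:Z = j * n%:Z); rewrite Zp_nat.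
  move/(congr1 val) => /= E; exists (p %/ n)%N%:Z.
  by rewrite -PoszM; congr Posz; rewrite {1}(divn_eq p n) E addn0.
case: (intP k) H => [|p|p] H; first by exists 0; rewrite mul0r.
- exact: nat0.
- have /nat0[j ->] : p.+1%:Z%:m = 0 by apply/oppr_inj; rewrite -mulrNz H oppr0.
  by exists (- j); rewrite mulNr.
Qed.

Lemma cast_eq k k' : (k%:m = k'%:m) <-> exists j : int, k = k' + j * n%:Z.
Proof.
split=> [E|[j ->]]; last first.
  have E : (j * n%:Z)%:m = 0 by apply/cast0P; exists j.
  by rewrite castD E addr0.
have /cast0P[j Ej] : (k - k')%:m = 0 by rewrite castD intrN E subrr.
by exists j; rewrite -Ej addrC subrK.
Qed.

(** Solutions are indexed by the integers, the universal cover of the cycle of levels: a winding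
    face lifts to one, and need not close up after a single turn. *)
Definition sol s e := forall k, e (k + 1) = e (k - 1) (+) s k%:m (e k).

(** For the solution with (e_0, e_1) = p, [sol_fwd s p j] is (e_j, e_(j+1)) and [sol_bwd s p j] is
    (e_(-j), e_(1-j)); the recurrence can be run in both directions. *)
Fixpoint sol_fwd s (p : bool * bool) (j : nat) : bool * bool :=
  if j is j'.+1 then
    let: (x, y) := sol_fwd s p j' in (y, x (+) s j%:Z%:m y) else p.

Fixpoint sol_bwd s (p : bool * bool) (j : nat) : bool * bool :=
  if j is j'.+1 then
    let: (x, y) := sol_bwd s p j' in (y (+) s (- j'%:Z)%:m x, x) else p.

Definition mk_sol s p k : bool :=
  match k with Posz j => (sol_fwd s p j).1 | Negz j => (sol_bwd s p j.+1).1 end.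

Lemma mk_sol_sol s p : sol s (mk_sol s p).
Proof.
move=> [[|j]|[|j]].
- rewrite /=; case: p => a b /=.
  by rewrite oppr0 -addbA addbb addbF.
- have -> : j.+1%:Z + 1 = j.+2 by lia.
  have -> : j.+1%:Z - 1 = j by lia.
  rewrite /=; by case: (sol_fwd s p j).
- have -> : Negz 0 + 1 = 0 by lia.
  have -> : Negz 0 - 1 = Negz 1 by lia.
  rewrite /=; case: p => a b /=.
  by rewrite NegzE -addbA addbb addbF.
- have -> : Negz j.+1 + 1 = Negz j by lia.
  have -> : Negz j.+1 - 1 = Negz j.+2 by lia.
  rewrite /=; case: (sol_bwd s p j) => a b /=.
  by rewrite !NegzE -!addbA addbb addbF.
Qed.

Lemma mk_sol0 s p : mk_sol s p 0 = p.1. Proof. by []. Qed.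
Lemma mk_sol1 s p : mk_sol s p 1 = p.2. Proof. by case: p. Qed.

Lemma sol_next s e k : sol s e -> e (k + 1 + 1) = e k (+) s (k + 1)%:m (e (k + 1)).
Proof. by move=> H; rewrite H addrK. Qed.

Lemma sol_prev s e k : sol s e -> e (k - 1) = e (k + 1) (+) s k%:m (e k).
Proof. by move=> ->; rewrite -addbA addbb addbF. Qed.

Lemma int_step_ind (P : int -> Prop) :
  P 0 -> (forall k, P k -> P (k + 1)) -> (forall k, P k -> P (k - 1)) -> forall k, P k.
Proof.
move=> H0 Hp Hm; elim/int_rec => [//|j IH|j IH].
- have -> : j.+1 = j%:Z + 1 :> int by lia.
  exact: Hp.
- have -> : - j.+1%:Z = - j%:Z - 1 by lia.
  exact: Hm.
Qed.

Lemma exists_sol s k0 a b : exists e, [/\ sol s e, e k0 = a & e (k0 + 1) = b].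
Proof.
move: a b; elim/int_step_ind: k0 => [|k IH|k IH] a b.
- exists (mk_sol s (a, b)); split; [exact: mk_sol_sol | exact: mk_sol0 | exact: mk_sol1].
- have [e [He H1 H2]] := IH (b (+) s (k + 1)%:m a) a; exists e; split=> //.
  by rewrite (sol_next _ He) H1 H2 -addbA addbb addbF.
- have [e [He H1 H2]] := IH b (a (+) s k%:m b); exists e; rewrite subrK; split=> //.
  by rewrite (sol_prev _ He) H1 H2 -addbA addbb addbF.
Qed.

Lemma exists_sol_prev s k0 a b : exists e, [/\ sol s e, e k0 = a & e (k0 - 1) = b].
Proof.
have [e [He H1 H2]] := exists_sol s (k0 - 1) b a; exists e; split=> //.
by rewrite subrK in H2.
Qed.

(** The recurrence has order two, is reversible, and its coefficients depend on the level only. *)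
Lemma sol_eq s e e' (i j : int) : sol s e -> sol s e' -> i%:m = j%:m ->
  e i = e' j -> e (i + 1) = e' (j + 1) -> forall k, e (i + k) = e' (j + k).
Proof.
move=> He He' ij E0 E1 k.
suff : e (i + k) = e' (j + k) /\ e (i + k + 1) = e' (j + k + 1) by case.
elim/int_step_ind: k => [|k [IH1 IH2]|k [IH1 IH2]]; first by rewrite !addr0.
- rewrite !(@addrA int _ k 1) (sol_next _ He) (sol_next _ He') IH1 IH2; split=> //.
  by rewrite !castD ij.
- rewrite !(@addrA int _ k (-1)) !subrK (sol_prev _ He) (sol_prev _ He') IH1 IH2; split=> //.
  by rewrite !castD ij.
Qed.

(* [t = false]: period n; [t = true]: antiperiod n. *)
Definition twisted (t : bool) e := forall k, e (k + n%:Z) = e k (+) t.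

Lemma twisted_mul t e j k : twisted t e -> e (k + j * n%:Z) = e k (+) (t && odd `|j|).
Proof.
move=> H; elim/int_step_ind: j => [|j IH|j IH]; first by rewrite mul0r addr0 andbF addbF.
- have -> : k + (j + 1) * n%:Z = (k + j * n%:Z) + n%:Z by ring.
  rewrite H IH odd_absS.
  by case: t {H IH} (odd _) (e k) => [] [] [].
- have := H (k + (j - 1) * n%:Z).
  have -> : k + (j - 1) * n%:Z + n%:Z = k + j * n%:Z by ring.
  rewrite IH odd_absP.
  by case: t {H IH} (odd _) (e _) (e k) => [] [] [] [].
Qed.

Lemma twisted_cast t e k k' : twisted t e -> k%:m = k'%:m ->
  exists x : bool, e k = e k' (+) (t && x).
Proof. by move=> H /cast_eq[j ->]; exists (odd `|j|); apply: twisted_mul. Qed.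

(** With one slope [q] at all levels, differences of solutions satisfy d_(k+1) = d_(k-1) + q d_k, in
    which [s] no longer appears. *)
Definition affine s (q : bool) := forall i a, s i a = s i false (+) (q && a).

(** The common type [t] gives all winding faces the same length, and makes sums of two solutions
    well defined on the levels. *)
Definition good s q t := affine s q /\ forall e, sol s e -> twisted t e.

Lemma affineE s q i a b : affine s q -> s i a = s i b (+) (q && (a (+) b)).
Proof. by move=> H; rewrite (H i a) (H i b); case: (s i false) q {H} a b => [] [] [] []. Qed.

(** For q = 0 the parity of k may be added to a solution. Both sequences have type [t], so the
    parity has period n. *)
Lemma good_evenF s t : good s false t -> ~~ odd n.
Proof.
move=> [A H]; have [e [He _ _]] := exists_sol s 0 false false.
have He' : sol s (fun k => e k (+) odd `|k|).
  move=> k; rewrite He (affineE (s := s) _ (e k (+) _) (e k) A) /= addbF.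
  rewrite odd_absS odd_absP.
  by case: (e _) (odd _) (s _ _) => [] [] [].
have := H _ He' 0; rewrite (H _ He) add0r /= => E.
by apply/negP => O; move: E; rewrite O; case: (e 0) t {H} => [] [].
Qed.

(** For q = 1 the sequence 0, 1, 1 of period 3 may be added to a solution, so it vanishes at n. If t
    = 1, shifting a solution by n would add the constant 1 to it; but the constant 1 does not solve
    the homogeneous recurrence. *)
Lemma good_dvd3 s t : good s true t -> (3 %| n)%N /\ t = false.
Proof.
move=> [A H]; have [e [He _ _]] := exists_sol s 0 false false.
have He' : sol s (fun k => e k (+) ((k %% 3)%Z != 0)).
  move=> k; rewrite He (affineE (s := s) _ (e k (+) _) (e k) A) /=.
  rewrite mod3_step.
  by case: (e _) (e k) (_ != _) (_ != _) (s _ _) => [] [] [] [] [].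
split.
- have := H _ He' 0; rewrite (H _ He) add0r /= => E.
  have : (n%:Z %% 3)%Z = 0 by move: E; case: (e 0) t {H} => [] [] /=; case: eqP.
  by lia.
- apply/negP => /[dup] tT _; rewrite {}tT in H.
  have Hn : sol s (fun k => e (k + n%:Z)).
    move=> k; have -> : k + 1 + n%:Z = k + n%:Z + 1 by ring.
    have -> : k - 1 + n%:Z = k + n%:Z - 1 by ring.
    by rewrite He castD cast_n addr0.
  have := Hn 0; rewrite !(H _ He) (affineE (s := s) _ (e 0 (+) _) (e 0) A) /= He /=.
  by case: (e _) (e 0) (s _ _) => [] [] [].
Qed.

(* The recurrence with solution [e], read off at the representatives 0 <= i < n of the levels. *)
Definition rec_of (q : bool) e i a : bool :=
  e ((i : nat)%:Z + 1) (+) e ((i : nat)%:Z - 1) (+) (q && (a (+) e (i : nat)%:Z)).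

Lemma rec_of_affine q e : affine (rec_of q e) q.
Proof. by move=> i a; rewrite /rec_of; case: (e _) (e _) (e _) q a => [] [] [] [] []. Qed.

(** Another representative of the level changes e_(k-1), e_k and e_(k+1) by the same multiple of t.
    The first and last change cancel, and that of e_k is multiplied by q. *)
Lemma rec_of_sol q e t : twisted t e -> q && t = false -> sol (rec_of q e) e.
Proof.
move=> H qt k; rewrite /rec_of.
have [j Ej] : exists j : int, k = ((k%:m : 'I_n) : nat)%:Z + j * n%:Z.
  by apply/cast_eq; rewrite cast_nat.
set r := ((k%:m : 'I_n) : nat)%:Z in Ej *.
have -> : e (k + 1) = e (r + 1) (+) (t && odd `|j|).
  by rewrite -twisted_mul // {1}Ej; congr e; ring.
have -> : e (k - 1) = e (r - 1) (+) (t && odd `|j|).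
  by rewrite -twisted_mul // {1}Ej; congr e; ring.
have -> : e k = e r (+) (t && odd `|j|) by rewrite -twisted_mul // {1}Ej.
by case: q t qt {H} (odd _) (e _) (e _) (e _) => [] [] // _ [] [] [] [].
Qed.

(** Any other solution differs from [e] by a homogeneous solution, of period 2 if q = 0 and 3 if q =
    1. This period divides n, so all solutions have the type of [e]. *)
Lemma rec_of_good q e t : twisted t e ->
  (if q then (3 %| n)%N && ~~ t else ~~ odd n) -> good (rec_of q e) q t.
Proof.
move=> H C; split; first exact: rec_of_affine.
have qt : q && t = false by case: q t {H} C => [] [] //; rewrite andbF.
have He := rec_of_sol H qt => e' He'.
pose d k := e' k (+) e k.
have dE k : d (k + 1) = d (k - 1) (+) (q && d k).
  rewrite /d He He' (affineE _ (e' k) (e k) (rec_of_affine q e)).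
  by case: q {H C qt He He' d} (e' _) (e' k) (e _) (e k) (rec_of _ _ _ _) => [] [] [] [] [] [].
suff D k : d (k + n%:Z) = d k.
  move=> k; move: (D k) (H k); rewrite /d.
  by case: t {H C qt} (e' _) (e' k) (e _) (e k) => [] [] [] [] [].
case: q C {H qt He He'} dE => [/andP[C _]|C] dE.
- have d3 k' : d (k' + 3) = d k'.
    have := dE (k' + 1); have := dE (k' + 1 + 1); rewrite !addrK /= => A B.
    have -> : k' + 3 = k' + 1 + 1 + 1 by ring.
    by rewrite A B; case: (d _) (d _) => [] [].
  have dm j : d (k + (3 * j)%N%:Z) = d k.
    elim: j => [|j IH]; first by rewrite muln0 addr0.
    by rewrite mulnS PoszD addrCA addrC d3.
  by rewrite -(dm (n %/ 3)%N) mulnC divnK.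
- have d2 k' : d (k' + 2) = d k'.
    have := dE (k' + 1); rewrite addrK addbF => <-; congr d; ring.
  have dm j : d (k + (2 * j)%N%:Z) = d k.
    elim: j => [|j IH]; first by rewrite muln0 addr0.
    by rewrite mulnS PoszD addrCA addrC d2.
  by rewrite -(dm (n %/ 2)%N) mulnC divnK // dvdn2.
Qed.

Definition neg_rec s i a := ~~ s i a.

Lemma neg_rec_affine s q : affine s q -> affine (neg_rec s) q.
Proof. by move=> A i a; rewrite /neg_rec A addNb. Qed.

(* c_k = [k mod 4 in {2, 3}] satisfies c_(k+1) + c_(k-1) = 1 and c_(k+n) = c_k + n/2 mod 2. *)
Lemma good_neg s t : good s false t -> good (neg_rec s) false (t (+) odd n./2).
Proof.
move=> G; have ev := good_evenF G; case: G => A H.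
split; first exact: neg_rec_affine.
move=> e He k.
have Hc : sol s (fun k => e k (+) odd `|(k %/ 2)%Z|).
  move=> k'; rewrite He /neg_rec (affineE _ (e k' (+) _) (e k') A) /= addbF.
  rewrite odd_half_step.
  by case: (e _) (odd _) (s _ _) => [] [] [].
have := H _ Hc k.
rewrite odd_half_shift //.
by case: (e _) (e _) (odd _) (odd _) t {H} => [] [] [] [] [].
Qed.

End Sequences.

(** An injection of the finite set of arcs into itself is onto. *)
Lemma graph_aut_fwd (V : finType) (adj : rel V) (g : {perm V}) :
  (forall u v, adj u v -> adj (g u) (g v)) -> graph_aut adj g.
Proof.
move=> H x y; apply/idP/idP; last exact: H.
have gi : injective (fun p : V * V => (g p.1, g p.2)).
  by move=> [a b] [a' b'] /= [/perm_inj -> /perm_inj ->].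
have E := imset_stable_eq (A := [set p | adj p.1 p.2]) gi.
move=> a; have : (g x, g y) \in [set p | adj p.1 p.2] by rewrite inE.
rewrite -E => [/imsetP[[u v]]|p]; last by rewrite !inE; apply: H.
by rewrite inE => /= uv [/perm_inj -> /perm_inj ->].
Qed.

(** * Presentations as C_n[2K_1] *)

Section Labelling.
Variables (m : nat) (V : finType) (adj : rel V).
Local Notation n := m.+3.
Local Notation "k %:m" := ((k%:~R)%R : 'I_n) (at level 2, format "k %:m").
Implicit Types (k d : int) (i : 'I_n) (s : 'I_n -> bool -> bool) (e : int -> bool).
Local Open Scope ring_scope.

(* Presents the graph as the lexicographic product C_n[2K_1]; [lev] and [sd] are the two coordinates. *)
Record labelling := Labelling {
  lev : V -> 'I_n;
  sd : V -> bool;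
  mk : 'I_n -> bool -> V;
  mkK : forall v, mk (lev v) (sd v) = v;
  lev_mk : forall i a, lev (mk i a) = i;
  sd_mk : forall i a, sd (mk i a) = a;
  adjE : forall u v, adj u v = (lev v == lev u + 1) || (lev u == lev v + 1) }.

Implicit Types L : labelling.

Definition vx L k a := mk L k%:m a.
Definition twin L v := mk L (lev L v) (~~ sd L v).
(* [lev v + lev v - lev u] is the level of the neighbours of [v] on the side opposite to [u]. *)
Definition opp_rec L s v u := mk L (lev L v + lev L v - lev L u) (sd L u (+) s (lev L v) (sd L v)).

Definition pm d := d = 1 \/ d = -1.

Lemma pm1 : pm 1. Proof. by left. Qed.
Lemma pmN1 : pm (-1). Proof. by right. Qed.
Lemma pmN d : pm d -> pm (- d). Proof. by case=> ->; [right | left]. Qed.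
Lemma pmM d d' : pm d -> pm d' -> pm (d * d').
Proof. by case=> ->; case=> ->; [left|right|right|left]. Qed.
Lemma pm_sq d : pm d -> d * d = 1. Proof. by case=> ->. Qed.

Lemma cast1_neq0 : 1%:m != 0.
Proof. by []. Qed.
Lemma cast2_neq0 : 2%:m != 0.
Proof. by apply/eqP => /(congr1 val). Qed.

Lemma castD_inj k k' d : (k + d)%:m = (k' + d)%:m -> k%:m = k'%:m.
Proof. rewrite !castD; exact: addIr. Qed.

Lemma pm_cast d d' : pm d -> pm d' -> d%:m = d'%:m -> d = d'.
Proof.
have D : 1%:m <> (-1)%:m :> 'I_n.
  by rewrite mulrNz => /(congr1 (fun x => x + 1%:m)); rewrite addNr -castD; apply/eqP/cast2_neq0.
by case=> ->; case=> -> // E; case: D; rewrite E.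
Qed.

Lemma vx_eq L k a k' b : vx L k a = vx L k' b -> k%:m = k'%:m /\ a = b.
Proof. by move=> E; split; [have := congr1 (lev L) E | have := congr1 (sd L) E]; rewrite ?lev_mk ?sd_mk. Qed.

Lemma vx_cast L k k' a : k%:m = k'%:m -> vx L k a = vx L k' a.
Proof. by rewrite /vx => ->. Qed.

Lemma vx_surj L v : v = vx L (lev L v : nat)%:Z (sd L v).
Proof. by rewrite /vx cast_nat mkK. Qed.

Lemma vx_ex L v : exists k a, v = vx L k a.
Proof. by exists (lev L v : nat)%:Z, (sd L v); apply: vx_surj. Qed.

Lemma adj_vx L k a d b : pm d -> adj (vx L k a) (vx L (k + d) b).
Proof.
move=> pd; rewrite (adjE L) !lev_mk !castD; case: pd => ->; first by rewrite eqxx.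
by rewrite mulrNz subrK eqxx orbT.
Qed.

Lemma nbrP L k a w : adj (vx L k a) w -> exists d b, pm d /\ w = vx L (k + d) b.
Proof.
rewrite (adjE L) lev_mk => /orP[]/eqP E.
- exists 1, (sd L w); split; first exact: pm1.
  by rewrite -[LHS](mkK L) E /vx castD.
- exists (-1), (sd L w); split; first exact: pmN1.
  by rewrite -[LHS](mkK L) /vx castD E mulrNz addrK.
Qed.

Lemma arcP L u v : adj u v -> exists k d a b, [/\ pm d, u = vx L (k + d) b & v = vx L k a].
Proof.
have Eu := vx_surj L u; rewrite {1}Eu => /nbrP[d [a [pd Ev]]].
exists ((lev L u : nat)%:Z + d), (- d), a, (sd L u); split=> //; first exact: pmN.
by rewrite addrK.
Qed.

Lemma lab_sym L : symmetric adj.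
Proof. by move=> u v; rewrite !(adjE L) orbC. Qed.

Lemma lab_irr L : irreflexive adj.
Proof.
move=> u; rewrite (adjE L) orbb; apply/negbTE; rewrite -{1}[lev L u]addr0 (inj_eq (addrI _)).
by rewrite eq_sym; apply: cast1_neq0.
Qed.

Lemma lab_deg4 L v : #|[set u | adj v u]| = 4%N.
Proof.
have [k [a ->]] := vx_ex L v.
have -> : [set u | adj (vx L k a) u] =
  [set vx L (k + 1) true; vx L (k + 1) false; vx L (k - 1) true; vx L (k - 1) false].
  apply/setP=> u; rewrite !inE; apply/idP/idP.
  - by case/nbrP=> d [[] [[]-> ->]]; rewrite eqxx ?orbT.
  - by rewrite -!orbA => /or4P[]/eqP->; apply: adj_vx; rewrite /pm; auto.
have D a' b' : (vx L (k + 1) a' == vx L (k - 1) b') = false.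
  apply/eqP => /vx_eq[+ _]; rewrite ![k + _]addrC => /castD_inj.
  by move/(pm_cast pm1 pmN1).
have E k' : (vx L k' true == vx L k' false) = false.
  by apply/eqP => /vx_eq[].
by rewrite -!setUA !cardsU1 !inE cards1 !D !E.
Qed.

Lemma twin_vx L k a : twin L (vx L k a) = vx L k (~~ a).
Proof. by rewrite /twin lev_mk sd_mk. Qed.

Lemma opp_rec_vx L s k a d b : opp_rec L s (vx L k a) (vx L (k + d) b) = vx L (k - d) (b (+) s k%:m a).
Proof.
rewrite /opp_rec !lev_mk !sd_mk /vx; congr mk.
by rewrite !castD mulrNz opprD addrA addrK.
Qed.

Lemma sol_pm s e k d : sol s e -> pm d -> e (k + d) (+) e (k - d) = s k%:m (e k).
Proof.
by move=> H; case=> ->; rewrite ?opprK H; case: (e _) (s _ _) => [] [].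
Qed.

(* Translates by [e + e'] over the level map k -> c + d k; well defined because [e] and [e'] have the same type [t]. *)
Lemma lab_iso L L' s s' q (t : bool) e e' d (c : int) :
  affine s q -> affine s' q -> sol s e -> sol s' e' -> twisted m t e -> twisted m t e' -> pm d ->
  exists g : {perm V}, [/\ graph_aut adj g,
    forall k, g (vx L k (e k)) = vx L' (c + d * k) (e' (c + d * k)),
    forall v, g (twin L v) = twin L' (g v),
    forall u v, adj u v -> g (opp_rec L s v u) = opp_rec L' s' (g v) (g u) &
    forall u v, adj u v -> g (opp_rec L (neg_rec s) v u) = opp_rec L' (neg_rec s') (g v) (g u)].
Proof.
move=> A A' He He' T T' pd.
pose h v := let k := (lev L v : nat)%:Z in
  vx L' (c + d * k) (sd L v (+) e k (+) e' (c + d * k)).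
have hE k a : h (vx L k a) = vx L' (c + d * k) (a (+) e k (+) e' (c + d * k)).
  rewrite /h lev_mk sd_mk; set r := (nat_of_ord k%:m)%:Z.
  have kr : r%:m = k%:m by rewrite /r cast_nat.
  have [j Ej] : exists j : int, r = k + j * n%:Z by apply/cast_eq.
  rewrite Ej (twisted_mul _ _ T).
  have -> : c + d * (k + j * n%:Z) = (c + d * k) + (d * j) * n%:Z by ring.
  rewrite (twisted_mul _ _ T').
  have -> : odd `|d * j| = odd `|j| by case: pd => ->; rewrite ?mul1r // mulN1r abszN.
  rewrite (@vx_cast _ _ (c + d * k)); last by apply/cast_eq; exists (d * j).
  by congr vx; case: (t && _) a (e _) (e' _) => [] [] [] [].
have hi : injective h.
  move=> u v; have [k [a ->]] := vx_ex L u; have [k' [b ->]] := vx_ex L v.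
  move=> H; have kk : k%:m = k'%:m.
    move: H; rewrite !hE; case/vx_eq; rewrite ![c + _]addrC => /castD_inj.
    by case: pd => ->; rewrite ?mul1r // !mulN1r !mulrNz => /oppr_inj.
  by move: H; rewrite (vx_cast L a kk) !hE => /vx_eq[_ /addIb/addIb ->].
have gE k a : perm hi (vx L k a) = vx L' (c + d * k) (a (+) e k (+) e' (c + d * k)).
  by rewrite permE.
(* Only the sum of [r] and [r'] along the two solutions enters. It is unchanged when both
   recurrences are negated, so one computation serves [s], [s'] and their negations. *)
have opp r r' : affine r q -> affine r' q ->
    (forall k, let k' := c + d * k in
      r k%:m (e k) (+) r' k'%:m (e' k') = s k%:m (e k) (+) s' k'%:m (e' k')) ->
    forall u v, adj u v -> perm hi (opp_rec L r v u) = opp_rec L' r' (perm hi v) (perm hi u).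
  move=> R R' rr u v /(arcP L)[k [d' [a [b [pd' -> ->]]]]].
  rewrite opp_rec_vx !gE.
  have -> : c + d * (k + d') = c + d * k + d * d' by ring.
  have -> : c + d * (k - d') = c + d * k - d * d' by ring.
  rewrite opp_rec_vx; congr vx; move: (rr k) => /=.
  rewrite (affineE _ a (e k) R) (affineE _ (a (+) e k (+) e' (c + d * k)) (e' (c + d * k)) R').
  have := sol_pm k He pd'; have := sol_pm (c + d * k) He' (pmM pd pd').
  by case: (e (k + d')) (e (k - d')) (e' (_ + _ * _ + _)) (e' (_ - _)) => [] [] [] [] <- <-;
  case: (e k) (e' (_ + _)) (r _ _) (r' _ _) a b (q) => [] [] [] [] [] [] [].
exists (perm hi); split.
- apply: graph_aut_fwd => u v /(arcP L)[k [d' [a [b [pd' -> ->]]]]].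
  rewrite !gE.
  have -> : c + d * (k + d') = c + d * k + d * d' by ring.
  rewrite (lab_sym L); apply: adj_vx; exact: pmM.
- by move=> k; rewrite gE addbb.
- by move=> v; have [k [a ->]] := vx_ex L v; rewrite twin_vx !gE twin_vx !addNb.
- exact: opp.
- apply: opp; try exact: neg_rec_affine.
  by move=> k; rewrite /neg_rec /= addNb addbN negbK.
Qed.

End Labelling.

(** * The model colour classes *)

Section FunctionCycle.
Variables (V : finType) (adj : rel V) (w : nat -> V) (N : nat).
Hypotheses (N3 : 3 <= N) (wN : forall k, w (k + N) = w k) (wadj : forall k, adj (w k) (w k.+1)).
Hypothesis winj : forall k k', k < N -> k' < N -> w k = w k' -> k = k'.

(** With [w] periodic on all of nat, the closing edge from w_(N-1) to w_N = w_0 is no special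
    case. *)
Definition fun_face : {set {set V}} := [set [set w k; w k.+1] | k : 'I_N].

Let s := mkseq w N.

Lemma fun_uniq : uniq s.
Proof.
rewrite map_inj_in_uniq ?iota_uniq // => x y; rewrite !mem_iota /= !add0n; exact: winj.
Qed.

Lemma fun_mem k : k < N -> w k \in s.
Proof. by move=> kN; rewrite map_f // mem_iota. Qed.

Lemma fun_next k : k < N -> next s (w k) = w k.+1.
Proof.
move=> kN; have ks := fun_mem kN.
have ik : index (w k) s = k.
  by rewrite -{1}(nth_mkseq (w 0) w kN) index_uniq ?size_mkseq //; exact: fun_uniq.
have sE : s = w 0 :: [seq w j | j <- iota 1 N.-1].
  by rewrite /s /mkseq -[in LHS](@prednK N) //; lia.
rewrite next_nth ks ik sE; case: (ltnP k.+1 N) => k1.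
- by rewrite (nth_map 0) ?nth_iota ?size_iota //; lia.
- by rewrite nth_default ?size_map ?size_iota; [rewrite -(wN 0); congr w; lia | lia].
Qed.

Lemma fun_faceE : fun_face = cycle_edges s.
Proof.
apply/setP=> e; apply/imsetP/imsetP=> [[k _ ->]|[x /mapP[k + ->] ->]].
- by exists (w k); rewrite ?fun_next // fun_mem.
- by rewrite mem_iota => kN; exists (Ordinal kN); rewrite //= fun_next.
Qed.

Lemma fun_is_face : is_face adj fun_face.
Proof.
exists s; split; [exact: fun_uniq | by rewrite size_mkseq | | exact: fun_faceE].
have cs : fcycle (next s) s := cycle_next fun_uniq.
apply: (@sub_in_cycle _ (mem s)) cs; last exact/allP.
move=> x y /mapP[k + ->]; rewrite mem_iota => kN _ /eqP <-.
by rewrite fun_next.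
Qed.

(** An edge occurring at two indices would be traversed in both directions, making the successor and
    the predecessor of a vertex equal. *)
Lemma card_fun_face : #|fun_face| = N.
Proof.
rewrite card_imset ?card_ord // => k k' /set2_eq[[/winj E _]|[E1 E2]].
  by apply/val_inj; apply: E; exact: ltn_ord.
have us := fun_uniq; have ss : 2 < size s by rewrite size_mkseq.
have ks := fun_mem (ltn_ord k').
have := next_neq_prev us ss ks.
by rewrite -{2}E2 -fun_next // prev_next // fun_next // -E1 eqxx.
Qed.

End FunctionCycle.

Section Models.
Variables (m : nat) (V : finType) (adj : rel V).
Local Notation n := m.+3.
Local Notation "k %:m" := ((k%:~R)%R : 'I_n) (at level 2, format "k %:m").
Implicit Types (k d : int) (i : 'I_n) (s : 'I_n -> bool -> bool) (e : int -> bool) (t : bool).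
Variable L : labelling m adj.
Local Open Scope ring_scope.

Let adjC := lab_sym L.

(** A solution of type t closes up after one turn around the levels if t = 0, after two if t = 1. *)
Definition period t : nat := if t then n.*2 else n.

Definition ed e k : {set V} := [set vx L k (e k); vx L (k + 1) (e (k + 1))].

Definition sol_face t e : {set {set V}} := fun_face (fun k : nat => vx L k (e k)) (period t).

(** Initial values (e_0, e_1) parametrise the solutions. For t = 1 a solution and its shift by n
    give the same face. *)
Definition through s t : {set {set {set V}}} :=
  [set sol_face t (mk_sol s p) | p : bool * bool].

Lemma through_period e t k k' : twisted m t e ->
  vx L k (e k) = vx L k' (e k') <-> exists j : int, k = k' + j * (period t)%:Z.
Proof.
move=> T; split.
- case/vx_eq => /cast_eq[j E]; rewrite {1}E (twisted_mul _ _ T) => H.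
  rewrite /period; case: t T H => T H; last by exists j.
  exists (j %/ 2)%Z; rewrite {1}E; congr (_ + _).
  have : odd `|j| = false by move: H; case: (e k') (odd _) => [] [].
  move: (n) => p; rewrite -muln2 PoszM => ?.
  have -> : j = (j %/ 2)%Z * 2 by lia.
  rewrite mulzK //; ring.
- case=> j E; have [j' [E' Hj']] : exists j' : int, j * (period t)%:Z = j' * n%:Z /\ (t -> odd `|j'| = false).
    rewrite /period; case: (t); last by exists j.
    exists (j * 2); split; last by move=> _; lia.
    by rewrite -muln2 PoszM mulrAC mulrA.
  rewrite E E' (twisted_mul _ _ T) (@vx_cast _ _ _ _ _ k'); last by apply/cast_eq; exists j'.
  by case: (t) Hj' => [->|] //=; rewrite addbF.
Qed.

Lemma ed_period e t k j : twisted m t e -> ed e (k + j * (period t)%:Z) = ed e k.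
Proof.
move=> T; rewrite /ed; congr [set _; _]; apply/(through_period _ _ T); exists j => //; ring.
Qed.

Lemma period_ge3 t : (3 <= period t)%N.
Proof. by rewrite /period; case: t; rewrite // -addnn; lia. Qed.

Lemma sol_faceP e t E : twisted m t e -> (E \in sol_face t e) <-> exists k, E = ed e k.
Proof.
move=> T; have edN (r : nat) : [set vx L r (e r); vx L r.+1 (e r.+1)] = ed e r.
  by rewrite /ed; have -> : r.+1%:Z = r%:Z + 1 by lia.
split; first by case/imsetP=> r _ ->; exists r.
case=> k ->; have P0 : (period t)%:Z != 0 by have := period_ge3 t; case: (period t).
have R0 := modz_ge0 k P0.
have R1 : (k %% (period t)%:Z)%Z < (period t)%:Z by apply: ltz_pmod; have := period_ge3 t; case: (period t).
have Ek := divz_eq k (period t)%:Z.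
case: (k %% _)%Z R0 R1 Ek => // r _ R1 Ek.
rewrite Ek addrC (ed_period _ _ T) -edN; apply/imsetP; exists (Ordinal (R1 : (r < period t)%N)) => //.
Qed.

Lemma sol_face_ok e t : twisted m t e -> is_face adj (sol_face t e) /\ #|sol_face t e| = period t.
Proof.
move=> T; have A1 (k : nat) : vx L (k + period t)%N (e (k + period t)%N) = vx L k (e k).
  by apply/(through_period _ _ T); exists 1; rewrite PoszD mul1r.
have A2 (k : nat) : adj (vx L k (e k)) (vx L k.+1 (e k.+1)).
  have -> : k.+1%:Z = k%:Z + 1 by lia.
  exact/adj_vx/pm1.
have A3 (k k' : nat) : (k < period t)%N -> (k' < period t)%N -> vx L k (e k) = vx L k' (e k') -> k = k'.
  move=> kN kN' /(through_period _ _ T)[j E].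
  have : (k%:Z == k'%:Z %[mod (period t)%:Z])%Z.
    by rewrite E addrC modzMDl.
  by rewrite !modz_nat !modn_small // => /eqP[].
have N3 := period_ge3 t.
split; first exact: (fun_is_face N3 A1 A2 A3).
exact: (card_fun_face N3 A1 A3).
Qed.

Lemma sol_face_ext e e' t : e =1 e' -> sol_face t e = sol_face t e'.
Proof. by move=> E; apply: eq_imset => k /=; rewrite !E. Qed.

Lemma throughP s t f : f \in through s t <-> exists e, sol s e /\ f = sol_face t e.
Proof.
split; first by case/imsetP=> p _ ->; exists (mk_sol s p); split=> //; apply: mk_sol_sol.
case=> e [He ->]; apply/imsetP; exists (e 0, e 1) => //.
apply: sol_face_ext => k; have := sol_eq He (mk_sol_sol s (e 0, e 1)) (erefl 0%:m).
by move=> /(_ _ _ k); rewrite !add0r mk_sol0 mk_sol1; apply.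
Qed.

(** As 2 is nonzero modulo n, the two ends of an edge are told apart by their levels, the upper one
    being the successor of the lower. *)
Lemma cast_step k k' d : pm d -> k%:m = (k' + d)%:m -> (k + d)%:m = k'%:m -> False.
Proof.
move=> pd E1; rewrite castD E1 !castD -addrA -[RHS]addr0 => /addrI; rewrite -castD.
have -> : d + d = d * 2 by ring.
by case: pd => -> /eqP; rewrite ?mul1r ?mulN1r ?mulrNz ?oppr_eq0 (negPf (cast2_neq0 m)).
Qed.

Lemma ed_eq e e' k k' : ed e k = ed e' k' ->
  [/\ k%:m = k'%:m, e k = e' k' & e (k + 1) = e' (k' + 1)].
Proof.
case/set2_eq=> [[/vx_eq[A B] /vx_eq[_ C]] //|[/vx_eq[A _] /vx_eq[B _]]].
case: (cast_step pm1 A B).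
Qed.

Lemma ed_pm e k d : pm d -> exists k', [set vx L k (e k); vx L (k + d) (e (k + d))] = ed e k'.
Proof.
case=> ->; first by exists k.
by exists (k - 1); rewrite /ed subrK setUC.
Qed.

Lemma sol_face_eq s e e' t k k' : sol s e -> sol s e' -> twisted m t e -> twisted m t e' ->
  ed e k = ed e' k' -> sol_face t e = sol_face t e'.
Proof.
move=> He He' T T' /ed_eq[A B C].
have E := sol_eq He He' A B C.
have Ex x : ed e (k + x) = ed e' (k' + x).
  by rewrite /ed -!addrA !E; congr [set _; _]; apply: vx_cast; rewrite !castD A.
apply/setP=> X; apply/idP/idP => /(sol_faceP _ _)[] // x ->; apply/sol_faceP => //.
- by exists (k' + (x - k)); rewrite -Ex addrC subrK.
- by exists (k + (x - k')); rewrite Ex addrC subrK.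
Qed.

(** An edge prescribes two consecutive values, hence one solution up to shifts by multiples of n,
    and so exactly one winding face. *)
Theorem through_cc s q t : good s q t -> colour_class adj (through s t) (opp_rec L s).
Proof.
case=> A T; split.
- by move=> f /throughP[e [He ->]]; case: (sol_face_ok (T _ He)).
- move=> u v /(arcP L)[k [d [a [b [pd -> ->]]]]].
  have [e [He Ek Ed]] : exists e, [/\ sol s e, e k = a & e (k + d) = b].
    by case: pd => ->; [apply: exists_sol | apply: exists_sol_prev].
  exists (sol_face t e); first by apply/throughP; exists e.
  apply/sol_faceP; first exact: T.
  by rewrite setUC -Ek -Ed; apply: ed_pm.
- move=> u v f f' /throughP[e [He ->]] /throughP[e' [He' ->]].
  move=> /(sol_faceP _ (T _ He))[k ->] /(sol_faceP _ (T _ He'))[k'].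
  exact: sol_face_eq (T _ He) (T _ He').
- move=> u v f fT uvf w; have /throughP[e [He fE]] := fT.
  have [Hf _] := sol_face_ok (T _ He); rewrite -fE in Hf.
  have [w' [wu aw Hw]] := face_deg adjC Hf uvf.
  suff H : [set v; opp_rec L s v u] \in f.
    rewrite Hw; have := Hw (opp_rec L s v u); rewrite H => /esym/orP[]/eqP E; last by rewrite E.
    have uv := face_adj adjC Hf uvf.
    have [k [d [a [b [pd Eu Ev]]]]] := arcP L uv.
    move: E; rewrite Eu Ev opp_rec_vx => /vx_eq[]; rewrite ![k + _]addrC => /castD_inj E _.
    by have := pm_cast (pmN pd) pd E; case: pd => ->.
  move: uvf; rewrite fE => /(sol_faceP _ (T _ He))[k E].
  apply/sol_faceP; first exact: T.
  have key k0 d : pm d -> u = vx L (k0 + d) (e (k0 + d)) -> v = vx L k0 (e k0) ->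
      exists k1, [set v; opp_rec L s v u] = ed e k1.
    move=> pd -> ->; rewrite opp_rec_vx.
    have -> : e (k0 + d) (+) s k0%:m (e k0) = e (k0 - d).
      by rewrite -(sol_pm _ He pd) addbA addbb.
    exact/ed_pm/pmN.
  case/set2_eq: E => [[Eu Ev]|[Eu Ev]].
  + by apply: (key (k + 1) (-1)); rewrite ?addrK //; apply: pmN1.
  + by apply: (key k 1) => //; apply: pm1.
Qed.

Lemma card_through s q t f : good s q t -> f \in through s t -> #|f| = period t.
Proof. by case=> A T /throughP[e [He ->]]; case: (sol_face_ok (T _ He)). Qed.

(** The closed walk (i,0), (i+1,0), (i,1), (i+1,1) in coordinates level and side. *)
Definition sq_vertex i (k : nat) := mk L (i + (odd k)%:R) (odd k./2).

Definition square i : {set {set V}} := fun_face (sq_vertex i) 4.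

Definition squares : {set {set {set V}}} := [set square i | i : 'I_n].

Lemma squareP i E : (E \in square i) <-> exists a b, E = [set mk L i a; mk L (i + 1) b].
Proof.
have N3 (k : nat) : (k < 4)%N -> [set sq_vertex i k; sq_vertex i k.+1] \in square i.
  by move=> k4; apply/imsetP; exists (Ordinal k4).
split.
- case/imsetP=> [[[|[|[|[|k]]]] //= k4]] _ ->; rewrite /sq_vertex /= !addr0.
  + by exists false, false.
  + by exists true, false; rewrite setUC.
  + by exists true, true.
  + by exists false, true; rewrite setUC.
- case=> [[] [[] ->]].
  + by have := N3 2 isT; rewrite /sq_vertex /= !addr0.
  + by have := N3 1%N isT; rewrite /sq_vertex /= !addr0 setUC.
  + by have := N3 3 isT; rewrite /sq_vertex /= !addr0 setUC.
  + by have := N3 0%N isT; rewrite /sq_vertex /= !addr0.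
Qed.

Lemma adj_mk i a b : adj (mk L i a) (mk L (i + 1) b).
Proof. by rewrite (adjE L) !lev_mk eqxx. Qed.

Lemma square_ok i : is_face adj (square i) /\ #|square i| = 4%N.
Proof.
have ne1 : i + 1 != i by rewrite -[X in _ != X]addr0 (inj_eq (addrI _)); apply: cast1_neq0.
have A1 (k : nat) : sq_vertex i (k + 4) = sq_vertex i k.
  by rewrite /sq_vertex !addnS addn0 /= !negbK.
have A2 (k : nat) : adj (sq_vertex i k) (sq_vertex i k.+1).
  rewrite /sq_vertex /=; case: (odd k); rewrite /= !addr0; last exact: adj_mk.
  rewrite adjC; exact: adj_mk.
have A3 (k k' : nat) : (k < 4)%N -> (k' < 4)%N -> sq_vertex i k = sq_vertex i k' -> k = k'.
  move=> k4 k4' E; move: (congr1 (lev L) E) (congr1 (sd L) E); rewrite !lev_mk !sd_mk.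
  move: k4 k4' {E}; case: k => [|[|[|[|k]]]] //; case: k' => [|[|[|[|k']]]] //= _ _;
  rewrite ?addr0 //= => /eqP; by rewrite ?(negPf ne1) // eq_sym (negPf ne1).
split; first exact: (fun_is_face _ A1 A2 A3).
exact: (card_fun_face _ A1 A3).
Qed.

Lemma square_inj i i' E : E \in square i -> E \in square i' -> i = i'.
Proof.
move=> /squareP[a [b ->]] /squareP[a' [b']].
case/set2_eq=> [[E1 _]|[E1 E2]]; first by have := congr1 (lev L) E1; rewrite !lev_mk.
have := congr1 (lev L) E1; have := congr1 (lev L) E2; rewrite !lev_mk => F2 F1.
case: (@cast_step (nat_of_ord i)%:Z (nat_of_ord i')%:Z _ pm1); by rewrite castD !cast_nat.
Qed.

Theorem squares_cc : colour_class adj squares (fun _ u => twin L u).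
Proof.
have in_sq u v : adj u v -> exists i, [set u; v] \in square i /\ [set v; twin L u] \in square i.
  rewrite (adjE L) => /orP[]/eqP E.
  - exists (lev L u); split; apply/squareP.
    + by exists (sd L u), (sd L v); rewrite -E !mkK.
    + by exists (~~ sd L u), (sd L v); rewrite -E mkK setUC.
  - exists (lev L v); split; apply/squareP.
    + by exists (sd L v), (sd L u); rewrite -E !mkK setUC.
    + by exists (sd L v), (~~ sd L u); rewrite -E mkK.
split.
- by move=> f /imsetP[i _ ->]; case: (square_ok i).
- by move=> u v /in_sq[i [H _]]; exists (square i) => //; apply: imset_f.
- move=> u v _ _ /imsetP[i _ ->] /imsetP[i' _ ->] H H'.
  by rewrite (square_inj H H').
- move=> u v _ /imsetP[i _ ->] H w; have [Hf _] := square_ok i.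
  have [w' [wu aw Hw]] := face_deg adjC Hf H.
  have [i' [H1 H2]] := in_sq _ _ (face_adj adjC Hf H).
  move: H2; rewrite -(square_inj H H1) !Hw => /orP[]/eqP E; last by rewrite E.
  by have := congr1 (sd L) E; rewrite sd_mk; case: (sd L u).
Qed.

Lemma card_squares f : f \in squares -> #|f| = 4%N.
Proof. by case/imsetP=> i _ ->; case: (square_ok i). Qed.

End Models.

(** * Symmetries and isomorphisms of the models *)

Section ModelMaps.
Variables (m : nat) (V : finType) (adj : rel V).
Local Notation n := m.+3.
Local Notation "k %:m" := ((k%:~R)%R : 'I_n) (at level 2, format "k %:m").
Implicit Types (k d : int) (i : 'I_n) (s : 'I_n -> bool -> bool) (e : int -> bool) (t : bool).
Implicit Type L : labelling m adj.
Local Open Scope ring_scope.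

Lemma exists_sol_pm s k d a b : pm d -> exists e, [/\ sol s e, e k = a & e (k + d) = b].
Proof. by case=> ->; [apply: exists_sol | apply: exists_sol_prev]. Qed.

(** Solutions through the two arcs exist and have the same type, so the translation by their sum is
    available. *)
Lemma lab_trans L s q t u v u' v' : good s q t -> adj u v -> adj u' v' ->
  exists g : {perm V}, [/\ graph_aut adj g, g u = u' /\ g v = v',
    forall w, g (twin L w) = twin L (g w),
    forall x y, adj x y -> g (opp_rec L s y x) = opp_rec L s (g y) (g x) &
    forall x y, adj x y -> g (opp_rec L (neg_rec s) y x) = opp_rec L (neg_rec s) (g y) (g x)].
Proof.
case=> A T /(arcP L)[k [d [a [b [pd -> ->]]]]] /(arcP L)[k' [d' [a' [b' [pd' -> ->]]]]].
have [e [He Ek Ed]] := exists_sol_pm s k a b pd.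
have [e' [He' Ek' Ed']] := exists_sol_pm s k' a' b' pd'.
(* The constant is chosen so that the level map x -> c + d'd x sends k to k' and k + d to k' +
   d'. *)
have [g [g1 g2 g3 g4 g5]] := lab_iso L L (k' - d' * d * k) A A He He' (T _ He) (T _ He') (pmM pd' pd).
exists g; split=> //; split.
- rewrite -Ed g2; have -> : k' - d' * d * k + d' * d * (k + d) = k' + d' * (d * d) by ring.
  by rewrite (pm_sq pd) mulr1 Ed'.
- by rewrite -Ek g2 subrK Ek'.
Qed.

Lemma twin_neq_opp L s u v : adj u v -> twin L u <> opp_rec L s v u.
Proof.
move=> /(arcP L)[k [d [a [b [pd -> ->]]]]]; rewrite twin_vx opp_rec_vx => /vx_eq[].
rewrite ![k + _]addrC => /castD_inj E _.
by have := pm_cast pd (pmN pd) E; case: pd => ->.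
Qed.

Theorem squares_through L s q t : good s q t ->
  two_colouring adj (squares L) (through L s t) (fun _ u => twin L u) (opp_rec L s).
Proof.
move=> G; have C1 := squares_cc L; have C2 := through_cc L G.
split=> // [u v u' v' uv uv'|u v uv]; last exact: twin_neq_opp.
have [g [g1 [g2 g2'] g3 g4 g5]] := lab_trans L G uv uv'; exists g; split=> //.
- by apply: (cc_iso (lab_sym L) g1 C1 C1) => x y _.
- exact: (cc_iso (lab_sym L) g1 C2 C2).
Qed.

Theorem through_through L s q t t' : good s q t -> good (neg_rec s) q t' ->
  two_colouring adj (through L s t) (through L (neg_rec s) t') (opp_rec L s) (opp_rec L (neg_rec s)).
Proof.
move=> G G'; have C1 := through_cc L G; have C2 := through_cc L G'.
split=> // [u v u' v' uv uv'|u v uv].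
  have [g [g1 [g2 g2'] g3 g4 g5]] := lab_trans L G uv uv'; exists g; split=> //.
  - exact: (cc_iso (lab_sym L) g1 C1 C1).
  - exact: (cc_iso (lab_sym L) g1 C2 C2).
move=> /(congr1 (sd L)); rewrite !sd_mk /neg_rec; by case: (sd L u) (s _ _) => [] [].
Qed.

(** One [g] serves the squares, the class of [s] and the class of its negation, so that unions of
    two colours are carried over as a whole. *)
Lemma good_iso L L' s s' q t : good s q t -> good s' q t ->
  exists g : {perm V}, [/\ graph_aut adj g, map_img g (squares L) = squares L',
    map_img g (through L s t) = through L' s' t &
    forall t1, good (neg_rec s) q t1 -> good (neg_rec s') q t1 ->
      map_img g (through L (neg_rec s) t1) = through L' (neg_rec s') t1].
Proof.
move=> G G'; have [A T] := G; have [A' T'] := G'.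
have [e [He _ _]] := exists_sol s 0 false false.
have [e' [He' _ _]] := exists_sol s' 0 false false.
have [g [g1 g2 g3 g4 g5]] := lab_iso L L' 0 A A' He He' (T _ He) (T' _ He') pm1.
have C1 := squares_cc L; have C1' := squares_cc L'.
exists g; split=> //.
- by apply: (cc_iso (lab_sym L) g1 C1 C1') => x y _.
- exact: (cc_iso (lab_sym L) g1 (through_cc L G) (through_cc L' G')).
- move=> t1 H H'; exact: (cc_iso (lab_sym L) g1 (through_cc L H) (through_cc L' H')).
Qed.

Lemma neg_recK s i a : neg_rec (neg_rec s) i a = s i a.
Proof. exact: negbK. Qed.

Lemma good_ext s s' q t : (forall i a, s i a = s' i a) -> good s q t -> good s' q t.
Proof.
move=> E [A T]; split; first by move=> i a; rewrite -!E.
by move=> e He; apply: T => k; rewrite E.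
Qed.

(** An isomorphism taking the class of s to that of s + 1 also takes the class of s + 1 to that of s
    + 2 = s. This is what [no_swap] forbids. *)
Lemma same_type_swap L s q t : good s q t -> good (neg_rec s) q t ->
  exists g : {perm V}, [/\ graph_aut adj g, map_img g (through L s t) = through L (neg_rec s) t &
    map_img g (through L (neg_rec s) t) = through L s t].
Proof.
move=> G G'; have G2 := good_ext (fun i a => esym (neg_recK s i a)) G.
have [g [g1 _ g3 g4]] := good_iso L L G G'; exists g; split=> //.
rewrite (g4 _ G' G2); apply: (cc_ext (lab_sym L) (through_cc L G2) (through_cc L G)) => u v _.
by rewrite /opp_rec neg_recK.
Qed.

End ModelMaps.

(** * Analysis of an arbitrary colour class *)

Section Analysis.
Variables (m : nat) (V : finType) (adj : rel V).
Local Notation n := m.+3.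
Local Notation "k %:m" := ((k%:~R)%R : 'I_n) (at level 2, format "k %:m").
Implicit Types (k d : int) (i : 'I_n) (s : 'I_n -> bool -> bool) (e : int -> bool) (t : bool).
Variable L : labelling m adj.
Local Open Scope ring_scope.

Let adjC := lab_sym L.

Lemma adj_twin u v : adj u v -> adj u (twin L v).
Proof.
move=> /(arcP L)[k [d [a [b [pd -> ->]]]]]; rewrite twin_vx adjC; exact: adj_vx.
Qed.

Section OneClass.
Variables (K : {set {set {set V}}}) (o : V -> V -> V).
Hypothesis C : colour_class adj K o.
Hypothesis T : forall u v u' v', adj u v -> adj u' v' -> exists g : {perm V},
  [/\ graph_aut adj g, g u = u', g v = v', map_img g K = K & forall w, g (twin L w) = twin L (g w)].

(** By transitivity the face turns back to the twin of u at every arc or at none. In the second case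
    it always crosses to the opposite side of v, where a bijection between two 2-sets is a
    translation of Z_2. *)
Lemma class_dichotomy : (forall u v, adj u v -> o v u = twin L u) \/
  (exists s q, affine s q /\ forall u v, adj u v -> o v u = opp_rec L s v u).
Proof.
have a0 : adj (vx L 0 false) (vx L (0 + 1) false) by exact/adj_vx/pm1.
case: (eqVneq (o (vx L (0 + 1) false) (vx L 0 false)) (twin L (vx L 0 false))) => [E0|N0].
  left=> u v uv; have [g [g1 <- <- g4 g5]] := T a0 uv.
  by rewrite -(cc_equiv adjC g1 C g4 a0) E0 g5.
have N u v : adj u v -> o v u <> twin L u.
  move=> uv E; have [g [g1 gu gv g4 g5]] := T uv a0.
  by move: N0; rewrite -gu -gv -(cc_equiv adjC g1 C g4 uv) E g5 eqxx.
right; have cross k a d b : pm d -> exists c, o (vx L k a) (vx L (k + d) b) = vx L (k - d) c.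
  move=> pd; have vu : adj (vx L k a) (vx L (k + d) b) := adj_vx L _ _ _ pd.
  have uv : adj (vx L (k + d) b) (vx L k a) by rewrite adjC.
  have := cc_neq adjC C uv; have := N _ _ uv.
  have [d' [c [pd' E]]] := nbrP (cc_adj adjC C uv).
  rewrite E twin_vx => N1 /eqP N2; exists c; congr vx.
  case: pd pd' N1 N2 => -> [] -> //.
  + by move=> N1 N2; case: (boolP (c == b)) => [/eqP|] H; [case: N2; rewrite H | case: N1; congr vx; case: c b H {E N2 uv vu} => [] []].
  + by move=> N1 N2; case: (boolP (c == b)) => [/eqP|] H; [case: N2; rewrite H | case: N1; congr vx; case: c b H {E N2 uv vu} => [] []].
pose s i a := sd L (o (mk L i a) (mk L (i - 1) false)).
have sE k a : s k%:m a = sd L (o (vx L k a) (vx L (k - 1) false)).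
  by rewrite /s /vx castD mulrNz.
have up k a b : o (vx L k a) (vx L (k - 1) b) = vx L (k + 1) (b (+) s k%:m a).
  rewrite sE; have [c0 E0] := cross k a (-1) false pmN1; rewrite E0 sd_mk.
  case: b; last by rewrite E0 opprK.
  have [c1 E1] := cross k a (-1) true pmN1; rewrite E1 opprK; congr vx.
  have H b : adj (vx L (k - 1) b) (vx L k a) by rewrite adjC; apply/adj_vx/pmN1.
  have := cc_invol adjC C (H true); have := cc_invol adjC C (H false); rewrite E0 E1.
  by case: c1 c0 {E0 E1} => [] [] //= ->; case/vx_eq.
have down k a b : o (vx L k a) (vx L (k + 1) b) = vx L (k - 1) (b (+) s k%:m a).
  have H : adj (vx L (k - 1) (b (+) s k%:m a)) (vx L k a) by rewrite adjC; apply/adj_vx/pmN1.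
  by rewrite -[RHS](cc_invol adjC C H) up -addbA addbb addbF.
have oE u v : adj u v -> o v u = opp_rec L s v u.
  move=> /(arcP L)[k [d [a [b [[] -> -> ->]]]]]; rewrite opp_rec_vx; first exact: down.
  by rewrite opprK; apply: up.
(* The slope records whether the continuations from u through v and through the twin of v end at
   different vertices. The automorphisms in [T] commute with [twin], so one arc decides for all. *)
exists s, (o (twin L (vx L (0 + 1) false)) (vx L 0 false) != o (vx L (0 + 1) false) (vx L 0 false)).
split=> // i a; case: a; rewrite /= ?andbF ?andbT ?addbF //.
have ai : adj (vx L ((i : nat)%:Z - 1) false) (vx L (i : nat)%:Z false).
  by rewrite adjC; apply/adj_vx/pmN1.
have [g [g1 gu gv g4 g5]] := T a0 ai.
rewrite -(inj_eq (@perm_inj _ g)) (cc_equiv adjC g1 C g4 a0) (cc_equiv adjC g1 C g4 (adj_twin a0)).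
rewrite g5 gu gv twin_vx !up cast_nat.
case: (s i true) (s i false) => [] []; rewrite ?eqxx //=; case: eqP => // /vx_eq[] //.
Qed.

(** The face through an edge follows a solution. If e_(k+n) = e_k for some k, simplicity of the face
    gives period n; otherwise e_(k+n) differs from e_k for all k. Transitivity makes the type common
    to all solutions. *)
Lemma class_good s q : affine s q -> (forall u v, adj u v -> o v u = opp_rec L s v u) ->
  exists t, good s q t.
Proof.
move=> A O.
have oE k a d b : pm d -> o (vx L k a) (vx L (k + d) b) = vx L (k - d) (b (+) s k%:m a).
  by move=> pd; rewrite O ?opp_rec_vx // adjC; apply: adj_vx.
have edge0 e : adj (vx L 0 (e 0)) (vx L (0 + 1) (e (0 + 1))) by exact/adj_vx/pm1.
have trace e f : sol s e -> f \in K -> ed L e 0 \in f -> forall k, ed L e k \in f.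
  move=> He fK f0; elim/int_step_ind=> [//|k IH|k IH].
  - rewrite /ed (cc_opp C fK IH); apply/orP; right; apply/eqP.
    have := oE (k + 1) (e (k + 1)) (-1) (e k) pmN1; rewrite addrK opprK => ->.
    by rewrite (sol_next _ He).
  - have IH' : [set vx L (k + 1) (e (k + 1)); vx L k (e k)] \in f by rewrite setUC.
    rewrite /ed subrK setUC (cc_opp C fK IH'); apply/orP; right; apply/eqP.
    by rewrite oE; [rewrite (sol_prev _ He) | apply: pm1].
have all_ed e f : sol s e -> f \in K -> ed L e 0 \in f -> forall E, E \in f -> exists k, E = ed L e k.
  move=> He fK f0; apply: (face_conn (cc_face C fK) f0); first by exists 0.
  move=> u v w uvf vwf [k E]; move: vwf; rewrite (cc_opp C fK uvf) => /orP[]/eqP->.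
    by exists k; rewrite setUC.
  have key k0 d : pm d -> u = vx L (k0 + d) (e (k0 + d)) -> v = vx L k0 (e k0) ->
      exists k1, [set v; o v u] = ed L e k1.
    move=> pd -> ->; rewrite oE //.
    have -> : e (k0 + d) (+) s k0%:m (e k0) = e (k0 - d).
      by rewrite -(sol_pm _ He pd) addbA addbb.
    exact/ed_pm/pmN.
  case/set2_eq: E => [[Eu Ev]|[Eu Ev]].
  + by apply: (key (k + 1) (-1)); rewrite ?addrK //; apply: pmN1.
  + by apply: (key k 1) => //; apply: pm1.
(* The face passes the vertex at k again at k + n. Only one of its two edges there leads to the next
   level, so the values at k + 1 and k + n + 1 agree as well. *)
have repeat e k : sol s e -> e (k + n%:Z) = e k -> twisted m false e.
  move=> He Ek; have [f fK f0] := cc_ex C (edge0 e).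
  have Hf := trace e f He fK f0.
  have kn x : (k + n%:Z + x)%:m = (k + x)%:m by rewrite !castD cast_n addr0.
  have Ek1 : e (k + n%:Z + 1) = e (k + 1).
    have := Hf (k + n%:Z); rewrite /ed Ek (vx_cast L _ (kn 1)).
    have -> : vx L (k + n%:Z) (e k) = vx L k (e k) by apply: vx_cast; rewrite castD cast_n addr0.
    have H : [set vx L (k + 1) (e (k + 1)); vx L k (e k)] \in f by rewrite setUC; apply: Hf.
    rewrite (cc_opp C fK H) => /orP[]/eqP; first by case/vx_eq.
    rewrite oE; last exact: pm1.
    case/vx_eq; rewrite ![k + _]addrC => /castD_inj E _; by have := pm_cast pm1 pmN1 E.
  have kn0 : (k + n%:Z)%:m = k%:m by rewrite castD cast_n addr0.
  have H := sol_eq He He kn0 Ek Ek1.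
  move=> x; rewrite addbF; have -> : x + n%:Z = k + n%:Z + (x - k) by ring.
  have -> : e x = e (k + (x - k)) by congr e; ring.
  exact: H.
have type e : sol s e -> exists t, twisted m t e.
  move=> He; case: (boolP (e (0 + n%:Z) == e 0)) => [/eqP E|D].
    by exists false; apply: repeat E.
  exists true => k; case: (boolP (e (k + n%:Z) == e k)) => [/eqP E|Dk].
    by move: D; rewrite (repeat e k He E 0) addbF eqxx.
  by case: (e _) (e k) Dk => [] [].
(* Whether the face through [uv] also visits the twin of [u] does not depend on the arc; it does iff t = 1. *)
pose Tw u v := exists f w, [/\ f \in K, [set u; v] \in f & [set twin L u; w] \in f].
have TwT u v u' v' : adj u v -> adj u' v' -> Tw u v -> Tw u' v'.
  move=> uv uv' [f [w [fK uvf twf]]]; have [g [g1 <- <- g4 g5]] := T uv uv'.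
  exists (face_img g f), (g w); split.
  - by rewrite -g4 mem_map_img.
  - by rewrite mem_face_img.
  - by rewrite -g5 mem_face_img.
have TwE e t : sol s e -> twisted m t e -> Tw (vx L 0 (e 0)) (vx L (0 + 1) (e (0 + 1))) <-> t.
  move=> He Ht; split.
  - case=> f [w [fK uvf]]; rewrite twin_vx => /(all_ed e f He fK uvf)[k].
    have no x : vx L 0 (~~ e 0) = vx L x (e x) -> t.
      case/vx_eq => E0 E1; have [y Ey] := twisted_cast Ht E0.
      by move: E1; rewrite Ey; case: (t) (y) (e x) => [] [] [].
    by case/set2_eq => [[/no] //|[/no]].
  - move=> tT; have [f fK f0] := cc_ex C (edge0 e).
    exists f, (vx L (n%:Z + 1) (e (n%:Z + 1))); split=> //.
    have -> : twin L (vx L 0 (e 0)) = vx L n%:Z (e n%:Z).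
      have := Ht 0; rewrite tT add0r addbT => ->.
      by rewrite twin_vx; apply: vx_cast; rewrite cast_n.
    exact: (trace e f He fK f0 n%:Z).
have [e0 [He0 _ _]] := exists_sol s 0 false false.
have [t Ht] := type _ He0; exists t; split=> // e He; have [t' Ht'] := type _ He.
suff -> : t = t' by [].
by apply/idP/idP => H; [apply/(TwE e t' He Ht'); apply: TwT (edge0 e0) (edge0 e) _; apply/(TwE e0 t He0 Ht)
 | apply/(TwE e0 t He0 Ht); apply: TwT (edge0 e) (edge0 e0) _; apply/(TwE e t' He Ht')].
Qed.

End OneClass.

(** The colours continue differently at each arc: they cannot both consist of squares, and two
    winding colours have recurrences s and s + 1, with equal slopes. *)
Theorem two_colouring_models K1 K2 o1 o2 : two_colouring adj K1 K2 o1 o2 ->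
  (forall g : {perm V}, graph_aut adj g -> map_img g K1 = K1 -> map_img g K2 = K2 ->
     forall v, g (twin L v) = twin L (g v)) ->
  [\/ exists s q t, [/\ good s q t, K1 = squares L & K2 = through L s t],
      exists s q t, [/\ good s q t, K2 = squares L & K1 = through L s t] |
      exists s q t t', [/\ good s q t, good (neg_rec s) q t', K1 = through L s t &
                           K2 = through L (neg_rec s) t']].
Proof.
move=> [C1 C2 T N] TW.
have T1 u v u' v' : adj u v -> adj u' v' -> exists g : {perm V},
  [/\ graph_aut adj g, g u = u', g v = v', map_img g K1 = K1 & forall w, g (twin L w) = twin L (g w)].
  by move=> a a'; have [g [? ? ? ? ?]] := T _ _ _ _ a a'; exists g; split=> //; apply: TW.
have T2 u v u' v' : adj u v -> adj u' v' -> exists g : {perm V},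
  [/\ graph_aut adj g, g u = u', g v = v', map_img g K2 = K2 & forall w, g (twin L w) = twin L (g w)].
  by move=> a a'; have [g [? ? ? ? ?]] := T _ _ _ _ a a'; exists g; split=> //; apply: TW.
have Csq := squares_cc L.
case: (class_dichotomy C1 T1) => [O1|[s [q [A O1]]]];
case: (class_dichotomy C2 T2) => [O2|[s2 [q2 [A2 O2]]]].
- have a0 : adj (vx L 0 false) (vx L (0 + 1) false) by exact/adj_vx/pm1.
  by case: (N _ _ a0); rewrite O1 // O2.
- have [t G] := class_good C2 T2 A2 O2.
  apply: Or31; exists s2, q2, t; split=> //.
  + exact: (cc_ext adjC C1 Csq O1).
  + exact: (cc_ext adjC C2 (through_cc L G) O2).
- have [t G] := class_good C1 T1 A O1.
  apply: Or32; exists s, q, t; split=> //.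
  + exact: (cc_ext adjC C2 Csq O2).
  + exact: (cc_ext adjC C1 (through_cc L G) O1).
- have sE i a : s2 i a = neg_rec s i a.
    have vu : adj (mk L i a) (vx L ((i : nat)%:Z + 1) false).
      have -> : mk L i a = vx L (i : nat)%:Z a by rewrite /vx cast_nat.
      exact/adj_vx/pm1.
    rewrite adjC in vu; have := N _ _ vu; rewrite O1 // O2 // /opp_rec !lev_mk !sd_mk /neg_rec.
    by case: (s i a) (s2 i a) => [] [].
  have qq : q2 = q.
    have := A2 0 true; rewrite !sE /neg_rec (A 0 true).
    by case: (s _ _) q q2 {A A2 O1 O2} => [] [] [].
  have [t G] := class_good C1 T1 A O1.
  have [t' G'] := class_good C2 T2 A2 O2.
  have G2 : good (neg_rec s) q t' by rewrite -qq; apply: good_ext G'.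
  apply: Or33; exists s, q, t, t'; split=> //.
  + exact: (cc_ext adjC C1 (through_cc L G) O1).
  + apply: (cc_ext adjC C2 (through_cc L G2)) => u v uv.
    by rewrite O2 // /opp_rec sE.
Qed.

End Analysis.

(** * Rose Window graphs *)

Section RoseWindow.
Variable m : nat.
Local Notation n := m.+3.
Local Notation "k %:m" := ((k%:~R)%R : 'I_n) (at level 2, format "k %:m").
Local Open Scope ring_scope.

(** The vertex y_j is adjacent to x_j and x_(j+2), which forces the level j + 1. *)
Definition rw_lev (v : rw_vertex n) : 'I_n := match v with inl i => i | inr j => j + 1 end.
Definition rw_sd (v : rw_vertex n) : bool := if v is inr _ then true else false.
Definition rw_mk (i : 'I_n) (a : bool) : rw_vertex n := if a then inr (i - 1) else inl i.

Lemma val_add1 (i : 'I_n) : val (i + 1) = ((i + 1) %% n)%N.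
Proof. by rewrite /= modnDmr. Qed.

Lemma rw_adjE (u v : rw_vertex n) :
  rw_adj n 2 1 u v = (rw_lev v == rw_lev u + 1) || (rw_lev u == rw_lev v + 1).
Proof.
have E1 (i j : 'I_n) : (val j == (i + 1) %% n)%N = (j == i + 1) by rewrite -val_add1.
have E2 (i j : 'I_n) : (val j == (i + n - 2) %% n)%N = (i == j + 1 + 1).
  rewrite -!val_eqE /= !modnDmr !modnDml.
  have := ltn_ord i; have := ltn_ord j; move: (nat_of_ord i) (nat_of_ord j) => a b /= bn an.
  apply/eqP/eqP=> [->|->].
  - rewrite -addnA modnDml; have -> : (a + n - 2 + (1 + 1) = a + n)%N by lia.
    by rewrite modnDr modn_small.
  - have -> : ((b + 1 + 1) %% n + n - 2 = (b + 1 + 1) %% n + (n - 2))%N by lia.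
    rewrite modnDml; have -> : (b + 1 + 1 + (n - 2) = b + n)%N by lia.
    by rewrite modnDr modn_small.
case: u v => i [] j; rewrite /rw_adj /rw_lev /=.
- by rewrite !E1.
- by rewrite E2 (inj_eq val_inj) (inj_eq (addIr _)).
- by rewrite E2 (inj_eq val_inj) (inj_eq (addIr _)) orbC eq_sym.
- by rewrite !E1 !(inj_eq (addIr _)).
Qed.

Lemma rw_mkK v : rw_mk (rw_lev v) (rw_sd v) = v.
Proof. by case: v => i //=; rewrite /rw_mk addrK. Qed.
Lemma rw_lev_mk i a : rw_lev (rw_mk i a) = i.
Proof. by case: a => //=; rewrite subrK. Qed.
Lemma rw_sd_mk i a : rw_sd (rw_mk i a) = a.
Proof. by case: a. Qed.

Definition rw_labelling : labelling m (rw_adj n 2 1) := Labelling rw_mkK rw_lev_mk rw_sd_mk rw_adjE.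

End RoseWindow.

(** * Twins as vertices with equal neighbourhoods *)

Section TwinInvariance.
Variables (m : nat) (V : finType) (adj : rel V) (L : labelling m adj).
Local Notation n := m.+3.
Local Notation "k %:m" := ((k%:~R)%R : 'I_n) (at level 2, format "k %:m").
Local Open Scope ring_scope.

Lemma cast_dvd (k : int) : k%:m = 0 -> (n %| `|k|)%N.
Proof. by case/cast0P=> j ->; rewrite abszM dvdn_mull. Qed.

(** The neighbouring levels k + 1 and k - 1 determine k unless k + 1 = k' - 1 and k - 1 = k' + 1,
    which gives 4 = 0 modulo n. *)
Lemma same_nbrs (u w : V) : n != 4%N -> (forall x, adj u x = adj w x) -> w = u \/ w = twin L u.
Proof.
move=> n4 H; have [k [a Eu]] := vx_ex L u; have [k' [b Ew]] := vx_ex L w.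
have lv d : pm d -> exists d', pm d' /\ (k + d - (k' + d'))%:m = 0.
  move=> pd; have := H (vx L (k + d) false); rewrite Eu adj_vx // Ew => /esym/nbrP[d' [c [pd' /vx_eq[E _]]]].
  by exists d'; rewrite castD intrN E subrr.
have kk : (k - k')%:m = 0.
  have [d [pd E]] := lv _ pm1; have [d' [pd' E']] := lv _ pmN1.
  case: pd E => -> E; first by rewrite -E; congr (_%:m); ring.
  case: pd' E' => -> E'; last by rewrite -E'; congr (_%:m); ring.
  have : 4%:m = 0 :> 'I_n.
    rewrite -[RHS](subrr 0) -{1}E -E' -intrN -castD; congr (_%:m); ring.
  move/cast_dvd => /[dup]/(dvdn_leq (isT : 0 < 4)%N) + D; move: D n4 {H lv E E'}.
  by case: (m) => [|[|]].
have kk' : k%:m = k'%:m by apply/eqP; rewrite -subr_eq0 -intrN -castD kk.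
rewrite Eu Ew twin_vx -(vx_cast L b kk'); case: (eqVneq b a) => [->|D]; [by left | right].
by congr vx; case: a b D {Eu Ew} => [] [].
Qed.

Lemma twin_neq (u : V) : twin L u <> u.
Proof. by move/(congr1 (sd L)); rewrite sd_mk; case: (sd L u). Qed.

Lemma adj_twinl (u x : V) : adj (twin L u) x = adj u x.
Proof. by rewrite !(adjE L) lev_mk. Qed.

Lemma aut_twin (g : {perm V}) : n != 4%N -> graph_aut adj g -> forall v, g (twin L v) = twin L (g v).
Proof.
move=> n4 Hg v; case: (@same_nbrs (g v) (g (twin L v)) n4) => // [x|/perm_inj/twin_neq //].
by rewrite -[x](permKV g) !Hg adj_twinl.
Qed.

End TwinInvariance.

(** * The case n = 4 *)

Section Pairing.

(** Three equal values would have a sum divisible by 3; otherwise one of the three values is taken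
    only once. *)
Lemma three_point_unique (T : finType) (P : {set T}) (f : T -> nat) :
  #|P| = 3 -> \sum_(y in P) f y = 4 -> exists2 y, y \in P & forall y', y' \in P -> f y' = f y -> y' = y.
Proof.
move=> P3; have /card_gt0P[a aP] : 0 < #|P| by rewrite P3.
have P2 : #|P :\ a| == 2 by have := cardsD1 a P; rewrite aP P3; lia.
have [b [c [bc Pbc]]] := elimT (cards2P _) P2.
have PE x : (x \in P) = [|| x == a, x == b | x == c].
  by rewrite -(setD1K aP) Pbc !inE.
have ba : b != a by have : b \in P :\ a by [rewrite Pbc set21]; rewrite !inE => /andP[].
have ca : c != a by have : c \in P :\ a by [rewrite Pbc set22]; rewrite !inE => /andP[].
rewrite (big_setD1 a) //= Pbc big_setU1 ?inE //= big_set1 => S.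
have [bP cP] : b \in P /\ c \in P by rewrite !PE !eqxx !orbT.
case: (eqVneq (f a) (f b)) => [fab|fab].
- exists c => // y; rewrite PE => /or3P[]/eqP-> // E; lia.
- case: (eqVneq (f a) (f c)) => [fac|fac].
  + exists b => // y; rewrite PE => /or3P[]/eqP-> // E; lia.
  + by exists a => // y; rewrite PE => /or3P[]/eqP-> // E; move: fab fac; rewrite E eqxx.
Qed.

Variables (V : finType) (adj : rel V) (L : labelling 1 adj).

(** For n = 4 the graph is the complete bipartite graph K_{4,4}, and the parity of the level gives
    its two parts. *)
Definition part v := odd (lev L v).

Lemma adj_part u v : adj u v = (part u != part v).
Proof.
rewrite (adjE L) /part; move: (lev L u) (lev L v) => [[|[|[|[|i]]]] //= Hi] [[|[|[|[|j]]]] //= Hj];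
by rewrite -!val_eqE.
Qed.

(** In K_{4,4} adjacency depends on the parts only, so the two pairs in each part may be placed
    arbitrarily on the two levels of that parity. *)
Lemma relabel (tau : V -> V) : involutive tau -> (forall x, tau x <> x) ->
  (forall x, part (tau x) = part x) -> exists L' : labelling 1 adj, forall v, twin L' v = tau v.
Proof.
move=> tK tN tP; have adjC := lab_sym L.
pose y0 := mk L 0%R false; pose w0 := mk L 1%R false.
have py : part y0 = false by rewrite /part lev_mk.
have pw : part w0 = true by rewrite /part lev_mk.
have [z wz /andP[zy zty]] := deg4_third (lab_deg4 L) w0 y0 (tau y0).
have [z' yz' /andP[zw ztw]] := deg4_third (lab_deg4 L) y0 w0 (tau w0).
have pz : part z = false by move: wz; rewrite adj_part pw; case: (part z).
have pz' : part z' = true by move: yz'; rewrite adj_part py; case: (part z').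
(* Representatives of the four pairs: y0 and z for the levels 0 and 2, w0 and z' for the levels 1
   and 3. *)
pose base (i : 'I_4) := if odd i then (if i == 1 :> nat then w0 else z')
                        else (if i == 0 :> nat then y0 else z).
have bP i : part (base i) = odd i.
  by rewrite /base; case: (odd i) => //; case: ifP.
have bI i i' : base i = base i' \/ base i = tau (base i') -> i = i'.
  move=> H; have oo : odd i = odd i' by case: H => /(congr1 part); rewrite ?tP !bP.
  have bad : (z == y0) || (z == tau y0) || (tau z == y0) = false.
    by rewrite (negPf zy) (negPf zty) -(inj_eq (inv_inj tK)) tK (negPf zty).
  have bad' : (z' == w0) || (z' == tau w0) || (tau z' == w0) = false.
    by rewrite (negPf zw) (negPf ztw) -(inj_eq (inv_inj tK)) tK (negPf ztw).
  apply/val_inj => /=; move: H oo; rewrite /base; case: i i' => [[|[|[|[|i]]]] Hi] [[|[|[|[|i']]]] Hi'] //= + _;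
  case=> E //; by [move: bad; rewrite -?E ?E ?eqxx ?orbT | move: bad'; rewrite -?E ?E ?eqxx ?orbT].
pose h v := if sd L v then tau (base (lev L v)) else base (lev L v).
have hT v : h (twin L v) = tau (h v).
  by rewrite /h lev_mk sd_mk; case: (sd L v); rewrite /= ?tK.
have hP v : part (h v) = part v by rewrite /h; case: (sd L v); rewrite ?tP bP.
have hI : injective h.
  move=> u v; rewrite -{2}(mkK L u) -{2}(mkK L v) /h; case: (sd L u); case: (sd L v).
  - by move/(inv_inj tK) => E; rewrite (bI _ _ (or_introl E)).
  - move/(congr1 tau); rewrite tK => E; have := bI _ _ (or_intror E) => E'.
    by case: (tN (base (lev L v))); rewrite -E E'.
  - move=> E; have := bI _ _ (or_intror E) => E'.
    by case: (tN (base (lev L v))); rewrite -E E'.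
  - by move=> E; rewrite (bI _ _ (or_introl E)).
pose g : {perm V} := perm hI; have gE u : g u = h u by rewrite permE.
have gP v : part ((g^-1)%g v) = part v by rewrite -[in RHS](permKV g v) gE hP.
pose lev' v := lev L ((g^-1)%g v); pose sd' v := sd L ((g^-1)%g v).
pose mk' i a := g (mk L i a).
have A1 v : mk' (lev' v) (sd' v) = v by rewrite /mk' mkK permKV.
have A2 i a : lev' (mk' i a) = i by rewrite /lev' /mk' permK lev_mk.
have A3 i a : sd' (mk' i a) = a by rewrite /sd' /mk' permK sd_mk.
have A4 u v : adj u v = (lev' v == lev' u + 1)%R || (lev' u == lev' v + 1)%R.
  by rewrite -adjE !adj_part !gP.
exists (Labelling A1 A2 A3 A4) => v; rewrite /twin /= /mk'.
by rewrite -[in RHS](permKV g v) !gE -hT.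
Qed.

(** [N y y'] counts the vertices at which the first colour joins y to y'. For fixed y, each of the 4
    neighbours contributes to one of the three other vertices in the part of y, so some count occurs
    exactly once. *)
Lemma canonical_pairing K1 K2 o1 o2 : two_colouring adj K1 K2 o1 o2 ->
  exists tau : V -> V, [/\ involutive tau, forall x, tau x <> x, forall x, part (tau x) = part x &
    forall g : {perm V}, graph_aut adj g -> map_img g K1 = K1 -> forall v, g (tau v) = tau (g v)].
Proof.
case=> [C1 _ T _]; have adjC := lab_sym L.
pose N y y' := #|[set x | adj x y && (o1 x y == y')]|.
pose P y := [set y' | (y' != y) && (part y' == part y)].
have NC y y' : N y y' = N y' y.
  apply: eq_card => x; rewrite !inE; apply/andP/andP=> [] [xy /eqP <-]; rewrite adjC in xy.
  - by rewrite (cc_adj adjC C1 xy) (cc_invol adjC C1 xy).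
  - by rewrite (cc_adj adjC C1 xy) (cc_invol adjC C1 xy).
have gN (g : {perm V}) y y' : graph_aut adj g -> map_img g K1 = K1 -> N (g y) (g y') = N y y'.
  move=> Hg gK; rewrite /N -[RHS](card_imset _ (@perm_inj _ g)); apply: eq_card => x.
  rewrite !inE -[x](permKV g) (mem_imset _ _ (@perm_inj _ g)) inE Hg.
  case: (boolP (adj _ y)) => //= xy.
  rewrite -(cc_equiv adjC Hg C1 gK) 1?adjC //; exact: (inj_eq (@perm_inj _ g)).
have sameP x y y' : adj x y -> adj x y' -> part y = part y'.
  by rewrite !adj_part; case: (part x) (part y) (part y') => [] [] [].
have nbr y : exists x, adj x y by have [x yx _] := deg4_third (lab_deg4 L) y y y; exists x; rewrite adjC.
have P3 y : #|P y| = 3.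
  have [x xy] := nbr y; have := cardsD1 y [set u | adj x u]; rewrite (lab_deg4 L) inE xy => -[->].
  apply: eq_card => u; rewrite !inE; case: (u == y) => //=.
  by move: xy; rewrite !adj_part; case: (part x) (part y) (part u) => [] [] [].
have NS y : \sum_(y' in P y) N y y' = 4.
  rewrite -(lab_deg4 L y) -sum1_card [RHS](partition_big (fun x => o1 x y) [in P y]) /=.
    by apply: eq_bigr => y' _; rewrite /N -sum1_card; apply: eq_bigl => x; rewrite !inE adjC.
  move=> x; rewrite !inE => yx; rewrite (cc_neq adjC C1) //=; apply/eqP.
  by apply: (sameP x); [apply: (cc_adj adjC C1) | rewrite adjC].
have y0 : V := mk L 0%R false.
have [z0 z0P z0u] := three_point_unique (P3 y0) (NS y0).
(* Transitivity makes the same count [nu] single out a partner of every y; the symmetry of [N] then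
   makes the pairing an involution. *)
pose nu := N y0 z0.
have Pg (g : {perm V}) y y' : graph_aut adj g -> (g y' \in P (g y)) = (y' \in P y).
  move=> Hg; rewrite !inE (inj_eq (@perm_inj _ g)); case: eqP => //= _.
  have [x xy] := nbr y; have gxy : adj (g x) (g y) by rewrite Hg.
  have := Hg x y'; move: xy gxy; rewrite !adj_part.
  by case: (part x) (part y) (part y') (part (g x)) (part (g y)) (part (g y')) => [] [] [] [] [] [].
have ex y : exists2 z, z \in P y & forall y', y' \in P y -> (N y y' == nu) = (y' == z).
  have [x0 xy0] := nbr y0; have [x xy] := nbr y.
  rewrite adjC in xy0; rewrite adjC in xy.
  have [g [Hg <- _ gK _]] := T _ _ _ _ xy0 xy.
  exists (g z0); first by rewrite Pg.
  move=> y'; rewrite -[y'](permKV g) Pg // gN // (inj_eq (@perm_inj _ g)) => yP.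
  by apply/eqP/eqP=> [/(z0u _ yP)|->].
pose tau y := odflt y [pick z | (z \in P y) && (N y z == nu)].
have tauE y : tau y \in P y /\ forall y', y' \in P y -> (N y y' == nu) = (y' == tau y).
  have [z zP Hz] := ex y; suff -> : tau y = z by [].
  rewrite /tau; case: pickP => [x /andP[xP]|/(_ z)]; first by rewrite Hz // => /eqP.
  by rewrite zP Hz // eqxx.
have PC y y' : y' \in P y -> y \in P y'.
  by rewrite !inE eq_sym => /andP[-> /eqP->]; rewrite eqxx.
exists tau; split.
- move=> y; have [yP Hy] := tauE y; have [_ Hz] := tauE (tau y).
  by have := Hz y (PC _ _ yP); rewrite NC (Hy _ yP) eqxx => /esym/eqP.
- by move=> y; have [+ _] := tauE y; rewrite inE => /andP[/eqP].
- by move=> y; have [+ _] := tauE y; rewrite inE => /andP[_ /eqP].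
- move=> g Hg gK y; have [yP Hy] := tauE y; have [_ Hz] := tauE (g y).
  have gP : g (tau y) \in P (g y) by rewrite Pg.
  by have := Hz _ gP; rewrite gN // (Hy _ yP) eqxx => /esym/eqP.
Qed.

End Pairing.

Section SwapFour.
Variables (V : finType) (adj : rel V) (L : labelling 1 adj).
Local Open Scope ring_scope.

Let s0 (i : 'I_4) (a : bool) := false.

(** For n = 4 and q = t = 0 both colours have faces of length 4 and can be exchanged, so their union
    is not of class 2_{0,1}. *)
Lemma swap_four : good s0 false false -> exists h : {perm V},
  [/\ graph_aut adj h, map_img h (squares L) = through L s0 false &
      map_img h (through L s0 false) = squares L].
Proof.
move=> G; have adjC := lab_sym L.
(* Read the four vertices of one parity as bit pairs and exchange the bits. *)
pose tr (i : 'I_4) (a : bool) : 'I_4 := inZp (odd i + a.*2)%N.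
pose h v := mk L (tr (lev L v) (sd L v)) (1 < lev L v)%N.
have hI : injective h.
  apply: (can_inj (g := h)) => v; rewrite /h lev_mk sd_mk -[RHS](mkK L).
  by move: (lev L v) (sd L v) => [[|[|[|[|i]]]] //= Hi] [] /=; congr mk; apply/val_inj.
have gE v : perm hI v = h v by rewrite permE.
have hP v : part L (h v) = part L v.
  rewrite /part lev_mk; by move: (lev L v) (sd L v) => [[|[|[|[|i]]]] //= Hi] [].
have C1 := squares_cc L; have C2 := through_cc L G.
have E1 u v : adj u v -> h (twin L u) = opp_rec L s0 (h v) (h u).
  rewrite (adjE L) /opp_rec /h /twin !lev_mk !sd_mk.
  move: (lev L u) (lev L v) (sd L u) (sd L v)
     => [[|[|[|[|i]]]] //= Hi] [[|[|[|[|j]]]] //= Hj] [] [] //= _; by congr mk; apply/val_inj.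
have E2 u v : adj u v -> h (opp_rec L s0 v u) = twin L (h u).
  rewrite (adjE L) /opp_rec /h /twin !lev_mk !sd_mk.
  move: (lev L u) (lev L v) (sd L u) (sd L v)
     => [[|[|[|[|i]]]] //= Hi] [[|[|[|[|j]]]] //= Hj] [] [] //= _; by congr mk; apply/val_inj.
have Hg : graph_aut adj (perm hI) by move=> u v; rewrite !gE !(adj_part L) !hP.
exists (perm hI); split=> //.
- by apply: (cc_iso adjC Hg C1 C2) => u v uv; rewrite !gE; apply: E1.
- by apply: (cc_iso adjC Hg C2 C1) => u v uv; rewrite !gE; apply: E2.
Qed.

Lemma good_s0 : good s0 false false.
Proof.
have T0 : twisted 1 false (fun _ => false) by [].
by apply: good_ext (rec_of_good (q := false) T0 isT) => i a.
Qed.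

End SwapFour.

(** The exchange for the zero recurrence, conjugated by an isomorphism to the given one. *)
Lemma squares_swap_four m (V : finType) (adj : rel V) (L : labelling m adj) s : m = 1 ->
  good s false false -> no_swap adj (squares L) (through L s false) -> False.
Proof.
move=> m1; subst m => G NS.
have [h [h1 h2 h3]] := swap_four L good_s0.
have [g [g1 g2 g3 _]] := good_iso L L G good_s0.
apply: (NS (g * h * g^-1)%g).
- by do !apply: graph_autM => //; apply: graph_autV.
- by rewrite !map_imgM g2 h2 (map_imgV g3).
- by rewrite !map_imgM g3 h3 (map_imgV g2).
Qed.

Lemma invariant_labelling m (V : finType) (adj : rel V) (L0 : labelling m adj) K1 K2 o1 o2 :
  two_colouring adj K1 K2 o1 o2 ->
  exists L : labelling m adj, forall g : {perm V}, graph_aut adj g -> map_img g K1 = K1 ->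
    map_img g K2 = K2 -> forall v, g (twin L v) = twin L (g v).
Proof.
case: (eqVneq m 1) => [m1|m1] TC; last first.
  by exists L0 => g Hg _ _; apply: aut_twin.
subst m; have [tau [tK tN tP tg]] := canonical_pairing L0 TC.
have [L HL] := relabel tK tN tP; exists L => g Hg gK _ v.
by rewrite !HL tg.
Qed.

(** * Classification *)

Section Classification.
Variable m : nat.
Local Notation n := m.+3.
Local Notation adj := (rw_adj n 2 1).
Local Notation V := (rw_vertex n).
Local Notation L0 := (rw_labelling m).
Implicit Types M : {set {set {set V}}}.

Definition zero_seq (k : int) := false.
(** Constant on each turn and flipped at every multiple of n: an antiperiodic sequence, realising t
    = 1. *)
Definition half_seq (k : int) := odd `|(k %/ n%:Z)%Z|.

Lemma zero_twisted : twisted m false zero_seq. Proof. by []. Qed.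

Lemma half_twisted : twisted m true half_seq.
Proof.
move=> k; rewrite /half_seq addbT -odd_absS; congr (odd `|_|).
by rewrite divzDr ?dvdzz // divzz.
Qed.

(** Representatives of the types (q, t) = (0, 0), (0, 1) and (1, 0); the type (1, 1) is impossible
    by [good_dvd3]. *)
Definition recA := @rec_of m false zero_seq.
Definition recB := @rec_of m false half_seq.
Definition recC := @rec_of m true zero_seq.

Lemma good_recA : ~~ odd n -> good recA false false.
Proof. by move=> H; apply: rec_of_good => //; apply: zero_twisted. Qed.
Lemma good_recB : ~~ odd n -> good recB false true.
Proof. by move=> H; apply: rec_of_good => //; apply: half_twisted. Qed.
Lemma good_recC : 3 %| n -> good recC true false.
Proof. by move=> H; apply: rec_of_good; [apply: zero_twisted | rewrite H]. Qed.

(** Here n/2 is odd, so passing from s to s + 1 changes the type. *)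
Lemma good_neg_recA : n %% 4 = 2 -> good (neg_rec recA) false true.
Proof.
move=> H; have ev : ~~ odd n by lia.
have := good_neg (good_recA ev); have -> // : odd n./2 = true by lia.
Qed.

Definition mapA := squares L0 :|: through L0 recA false.
Definition mapB := squares L0 :|: through L0 recB true.
Definition mapC := squares L0 :|: through L0 recC false.
Definition mapD := through L0 recA false :|: through L0 (neg_rec recA) true.

Lemma good_twist_uniq s q t t' : @good m s q t -> good s q t' -> t = t'.
Proof.
move=> [A T] [_ T']; have [e [He _ _]] := exists_sol s 0%R false false.
by move: (T _ He 0%R); rewrite (T' _ He); case: (e _) t t' {T T'} => [] [] [].
Qed.

Theorem classify M : class2_01 adj M ->
  [\/ [/\ ~~ odd n, n != 4 & map_iso adj M mapA], ~~ odd n /\ map_iso adj M mapB,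
      3 %| n /\ map_iso adj M mapC | n %% 4 = 2 /\ map_iso adj M mapD].
Proof.
move=> HM; have [K1 [K2 [o1 [o2 [MK TC NS]]]]] :=
  class2_two_colouring (lab_sym L0) (lab_irr L0) (deg4_third (lab_deg4 L0)) HM.
have [L TW] := invariant_labelling L0 TC.
have squaresP s q t : good s q t -> no_swap adj (squares L) (through L s t) ->
    M = squares L :|: through L s t ->
  [\/ [/\ ~~ odd n, n != 4 & map_iso adj M mapA], ~~ odd n /\ map_iso adj M mapB,
      3 %| n /\ map_iso adj M mapC | n %% 4 = 2 /\ map_iso adj M mapD].
  move=> G ns ME; case: q G => G.
    have [d3 t0] := good_dvd3 G; rewrite {}t0 in G ME.
    have [g [g1 g2 g3 _]] := good_iso L L0 G (good_recC d3).
    by apply: Or43; split=> //; exists g; split=> //; rewrite ME map_imgU g2 g3.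
  have ev := good_evenF G; case: t G ns ME => G ns ME.
    have [g [g1 g2 g3 _]] := good_iso L L0 G (good_recB ev).
    by apply: Or42; split=> //; exists g; split=> //; rewrite ME map_imgU g2 g3.
  apply: Or41; split=> //.
    by apply/eqP=> -[m1]; apply: (squares_swap_four m1 G ns).
  have [g [g1 g2 g3 _]] := good_iso L L0 G (good_recA ev).
  by exists g; split=> //; rewrite ME map_imgU g2 g3.
have throughP s : good s false false -> good (neg_rec s) false true -> 
    M = through L s false :|: through L (neg_rec s) true -> n %% 4 = 2 /\ map_iso adj M mapD.
  move=> G G' ME; have ev := good_evenF G.
  (* The type of s + 1 is the parity of n/2, and it has to be 1. *)
  have n4 : n %% 4 = 2.
    have := good_twist_uniq (good_neg G) G'; rewrite addFb; lia.
  split=> //.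
  have [g [g1 g2 g3 g4]] := good_iso L L0 G (good_recA ev).
  by exists g; split=> //; rewrite ME map_imgU g3 g4 //; apply: good_neg_recA.
case: (two_colouring_models TC TW).
- move=> [s [q [t [G E1 E2]]]]; apply: (squaresP _ _ _ G); by rewrite -E1 -E2.
- move=> [s [q [t [G E1 E2]]]]; apply: (squaresP _ _ _ G); rewrite -E1 -E2.
  + by move=> g Hg A B; apply: (NS g Hg B A).
  + by rewrite setUC; exact: MK.
- move=> [s [q [t [t' [G G' E1 E2]]]]].
  case: (eqVneq t t') => [E|D].
    rewrite -E in G' E2; have [g [g1 g2 g3]] := same_type_swap L G G'.
    by case: (NS g); rewrite // E1 E2.
  apply: Or44; case: q G G' => G G'.
    by move: D; rewrite (good_dvd3 G).2 (good_dvd3 G').2.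
  (* If the first colour has type 1, the colours exchange roles, s being the negation of s + 1. *)
  case: t t' D G G' E1 E2 => [] [] // _ G G' E1 E2.
  + have G2 := good_ext (fun i a => esym (neg_recK s i a)) G.
    apply: (throughP (neg_rec s)) => //.
    rewrite MK E1 E2 setUC; congr (_ :|: _).
    by apply: (cc_ext (lab_sym L) (through_cc L G) (through_cc L G2)) => u v _; rewrite /opp_rec neg_recK.
  + by apply: (throughP s) => //; rewrite MK E1 E2.
Qed.

End Classification.

(** * Isomorphism invariants *)

Section Isomorphism.
Variables (V : finType) (adj : rel V).
Implicit Types M : {set {set {set V}}}.

Lemma map_iso_sym M M' : map_iso adj M M' -> map_iso adj M' M.
Proof. by case=> g [Hg E]; exists (g^-1)%g; split; [apply: graph_autV | apply: map_imgV]. Qed.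

Lemma face_lengths_iso M M' l l' : map_iso adj M M' -> face_lengths M l -> face_lengths M' l' -> l =i l'.
Proof.
move=> [g [_ <-]] F F' k; apply/idP/idP.
- move/F => [f fM <-]; apply/F'; exists (face_img g f); first by rewrite mem_map_img.
  exact: card_face_img.
- by move/F' => [_ /imsetP[f fM ->] <-]; apply/F; exists f => //; rewrite card_face_img.
Qed.

Lemma face_lengthsU (K1 K2 : {set {set {set V}}}) l1 l2 :
  (forall f, f \in K1 -> #|f| = l1) -> (forall f, f \in K2 -> #|f| = l2) ->
  K1 != set0 -> K2 != set0 -> face_lengths (K1 :|: K2) [:: l1; l2].
Proof.
move=> H1 H2 /set0Pn[f1 K1f] /set0Pn[f2 K2f] k; rewrite !inE; split.
- by case=> f /setUP[] fK <-; [rewrite (H1 _ fK) eqxx | rewrite (H2 _ fK) eqxx orbT].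
- by case/orP=> /eqP->; [exists f1; rewrite ?inE ?K1f ?H1 | exists f2; rewrite ?inE ?K2f ?orbT ?H2].
Qed.

(** Faces are sets of edges, so having no common vertex is expressed by disjointness of their
    edges. *)
Definition disjoint_faces (l : nat) M := exists f f', [/\ f \in M, f' \in M, #|f| = l, #|f'| = l &
  forall e e', e \in f -> e' \in f' -> [disjoint e & e']].

Lemma disjoint_faces_iso l M M' : map_iso adj M M' -> disjoint_faces l M -> disjoint_faces l M'.
Proof.
case=> g [_ <-] [f [f' [fM fM' cf cf' D]]]; exists (face_img g f), (face_img g f').
rewrite !mem_map_img !card_face_img; split=> // _ _ /imsetP[e ef ->] /imsetP[e' ef' ->].
by rewrite (imset_disjoint (@perm_inj _ g)); apply: D.
Qed.

End Isomorphism.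

(** * The four models, their face lengths and non-isomorphism *)

Section Models.
Variable m : nat.
Local Notation n := m.+3.
Local Notation adj := (rw_adj n 2 1).
Local Notation V := (rw_vertex n).
Local Notation L0 := (rw_labelling m).
Implicit Types M : {set {set {set V}}}.

Lemma squares_neq0 : squares L0 != set0.
Proof. by apply/set0Pn; exists (square L0 0%R); apply: imset_f. Qed.

Lemma through_neq0 s t : through L0 s t != set0.
Proof. by apply/set0Pn; exists (sol_face L0 t (mk_sol s (false, false))); apply: imset_f. Qed.

(** The condition on the period separates the lengths of the two colours; it fails only for n = 4
    and t = 0. *)
Lemma squares_through_model s q t : good s q t -> period m t != 4 ->
  class2_01 adj (squares L0 :|: through L0 s t) /\
  face_lengths (squares L0 :|: through L0 s t) [:: 4; period m t].
Proof.
move=> G D; have C2 f : f \in through L0 s t -> #|f| = period m t by apply: (card_through G).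
split.
- apply: (two_colouring_class2 (lab_sym L0) (lab_deg4 L0) (mk L0 0%R false)
    (squares_through L0 G) (@card_squares _ _ _ L0) C2); by rewrite eq_sym.
- exact: (face_lengthsU (@card_squares _ _ _ L0) C2 squares_neq0 (through_neq0 _ _)).
Qed.

Lemma modelA : ~~ odd n -> n != 4 -> class2_01 adj (mapA m) /\ face_lengths (mapA m) [:: 4; n].
Proof. by move=> ev n4; apply: (squares_through_model (good_recA ev)). Qed.

Lemma modelB : ~~ odd n -> class2_01 adj (mapB m) /\ face_lengths (mapB m) [:: 4; 2 * n].
Proof.
move=> ev; rewrite mul2n; apply: (squares_through_model (good_recB ev)).
by rewrite /period -addnn; lia.
Qed.

Lemma modelC : 3 %| n -> class2_01 adj (mapC m) /\ face_lengths (mapC m) [:: 4; n].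
Proof.
by move=> d3; apply: (squares_through_model (good_recC d3)); rewrite /period; lia.
Qed.

Lemma modelD : n %% 4 = 2 -> class2_01 adj (mapD m) /\ face_lengths (mapD m) [:: n; 2 * n].
Proof.
move=> H; have ev : ~~ odd n by lia.
have G := good_recA ev; have G' := good_neg_recA H; rewrite mul2n.
have C1 f : f \in through L0 (@recA m) false -> #|f| = n by apply: (card_through G).
have C2 f : f \in through L0 (neg_rec (@recA m)) true -> #|f| = n.*2 by apply: (card_through G').
split.
- apply: (two_colouring_class2 (lab_sym L0) (lab_deg4 L0) (mk L0 0%R false)
    (through_through L0 G G') C1 C2); rewrite -addnn; lia.
- exact: (face_lengthsU C1 C2 (through_neq0 _ _) (through_neq0 _ _)).
Qed.

Lemma niso_lengths M M' l l' k : face_lengths M l -> face_lengths M' l' ->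
  (k \in l) != (k \in l') -> ~ map_iso adj M M' /\ ~ map_iso adj M' M.
Proof.
move=> F F' D; have N : ~ map_iso adj M M'.
  by move=> H; move: D; rewrite (face_lengths_iso H F F') eqxx.
by split=> // /map_iso_sym.
Qed.

Lemma recAE (i : 'I_n) a : recA i a = false. Proof. by []. Qed.
Lemma recCE (i : 'I_n) a : recC i a = a. Proof. by rewrite /recC /rec_of /= addbF. Qed.

(* Two big faces without common vertex exist in [mapA] but not in [mapC]. *)
Lemma nisoAC : ~~ odd n -> 3 %| n -> ~ map_iso adj (mapA m) (mapC m) /\ ~ map_iso adj (mapC m) (mapA m).
Proof.
move=> ev d3; suff N : ~ map_iso adj (mapA m) (mapC m) by split=> // /map_iso_sym.
move=> /(@disjoint_faces_iso _ _ n) H.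
have G := good_recA ev; have G' := good_recC d3.
have edgeP f (e : {set V}) (s : 'I_n -> bool -> bool) q e0 : good s q false -> sol s e0 ->
    f = sol_face L0 false e0 -> e \in f -> exists k, e = ed L0 e0 k.
  by move=> Gs He -> ef; case: Gs => _ T; apply/(sol_faceP L0 e (T _ He)).
case: H.
(* Since [recA] vanishes, the constants 0 and 1 are solutions; their faces are the cycle through all
   x_i and the cycle through all y_i. *)
- exists (sol_face L0 false (fun _ => false)), (sol_face L0 false (fun _ => true)).
  have S0 : sol (@recA m) (fun _ => false) by move=> k; rewrite recAE.
  have S1 : sol (@recA m) (fun _ => true) by move=> k; rewrite recAE.
  have T0 : sol_face L0 false (fun _ => false) \in through L0 (@recA m) false.
    by apply/throughP; exists (fun _ => false).
  have T1 : sol_face L0 false (fun _ => true) \in through L0 (@recA m) false.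
    by apply/throughP; exists (fun _ => true).
  split; rewrite ?(card_through G T0) ?(card_through G T1) //; try by rewrite inE ?T0 ?T1 orbT.
  move=> e e' /(edgeP _ _ _ _ _ G S0 erefl)[k ->] /(edgeP _ _ _ _ _ G S1 erefl)[k' ->].
  apply/pred0P=> x /=; apply/negbTE/negP=> /andP[].
  by rewrite !inE => /orP[]/eqP-> /orP[]/eqP/vx_eq[].
- move=> f [f' [fM fM' cf cf' D]].
  (* As 3 divides n, n is not 4, and a face of length n is not a square. *)
  have inT h : h \in mapC m -> #|h| = n -> h \in through L0 (@recC m) false.
    by case/setUP=> // /card_squares -> E; suff : 3 %| 4 by []; rewrite [X in _ %| X]E.
  have /throughP[e [He fE]] := inT _ fM cf.
  have /throughP[e' [He' fE']] := inT _ fM' cf'.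
  (* The difference of the solutions satisfies d_(k+1) = d_(k-1) + d_k, so it is not 1 at three
     consecutive places. *)
  have [k Ek] : exists k : int, e k = e' k.
    have := He 1%R; have := He' 1%R; rewrite !recCE.
    case: (eqVneq (e 1%R) (e' 1%R)) => [E|N1]; first by exists 1%R.
    case: (eqVneq (e (1 - 1)%R) (e' (1 - 1)%R)) => [E|N2]; first by exists (1 - 1)%R.
    move=> E1 E2; exists (1 + 1)%R; rewrite E1 E2.
    by move: N1 N2; case: (e _) (e' _) (e _) (e' _) => [] [] [] [].
  have [T T'] : twisted m false e /\ twisted m false e' by case: G' => _ T; split; apply: T.
  have ef : ed L0 e k \in f by rewrite fE; apply/(sol_faceP L0 _ T); exists k.
  have ef' : ed L0 e' k \in f' by rewrite fE'; apply/(sol_faceP L0 _ T'); exists k.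
  move/pred0P: (D _ _ ef ef') => /(_ (vx L0 k (e k))) /=.
  by rewrite /ed Ek !set21.
Qed.

Lemma gcd6 (p : nat) : (gcdn p 6 != 1) = (~~ odd p) || (3 %| p).
Proof.
rewrite -[gcdn p 6 == 1]/(coprime p (2 * 3)) coprimeMr coprimen2 negb_and.
by rewrite coprime_sym prime_coprime // negbK.
Qed.

End Models.

(** * The lists of maps for each residue of n modulo 12 *)

Lemma classifiedI (V : finType) (adj : rel V) (Ms : seq {set {set {set V}}}) (l : seq (seq nat)) :
  size Ms = size l ->
  (forall i, i < size Ms -> class2_01 adj (nth set0 Ms i) /\ face_lengths (nth set0 Ms i) (nth [::] l i)) ->
  (forall i j, i < j -> j < size Ms -> ~ map_iso adj (nth set0 Ms i) (nth set0 Ms j)) ->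
  (forall M, class2_01 adj M -> exists2 i, i < size Ms & map_iso adj M (nth set0 Ms i)) ->
  classified adj l.
Proof.
move=> H1 H2 H3 H4; exists Ms; split=> // i j iM jM.
case: (ltngtP i j) => // ij _; first exact: H3.
by move/map_iso_sym; apply: H3.
Qed.

Theorem theorem3p3 (n : nat) (hn : 3 <= n) :
  ((exists M, class2_01 (rw_adj n 2 1) M) <-> gcdn n 6 != 1) /\
  (n = 4 -> classified (rw_adj n 2 1) [:: [:: 4; 8]]) /\
  (n %% 12 \in [:: 3; 9] -> classified (rw_adj n 2 1) [:: [:: 4; n]]) /\
  (n %% 12 \in [:: 4; 8] -> n != 4 ->
     classified (rw_adj n 2 1) [:: [:: 4; n]; [:: 4; 2 * n]]) /\
  (n %% 12 \in [:: 2; 10] ->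
     classified (rw_adj n 2 1) [:: [:: 4; n]; [:: 4; 2 * n]; [:: n; 2 * n]]) /\
  (n %% 12 = 0 ->
     classified (rw_adj n 2 1) [:: [:: 4; n]; [:: 4; n]; [:: 4; 2 * n]]) /\
  (n %% 12 = 6 ->
     classified (rw_adj n 2 1)
       [:: [:: 4; n]; [:: 4; n]; [:: 4; 2 * n]; [:: n; 2 * n]]).
Proof.
case: n hn => [|[|[|m]]] // _.
split.
  rewrite gcd6; split.
  - by case=> M /classify[] [] => [-> //|-> //|->|]; rewrite ?orbT // => H _; apply/orP; left; lia.
  - case/orP=> H.
    + by exists (mapB m); case: (modelB H).
    + by exists (mapC m); case: (modelC H).
have m_in k r : m.+3 %% 12 \in [:: k; r] -> m.+3 %% 12 = k \/ m.+3 %% 12 = r.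
  by rewrite !inE => /orP[]/eqP; auto.
do !split.
(* For n = 4 only [mapB] survives: [classify] yields [mapA] only for n different from 4, and neither
   3 divides 4 nor is 4 = 2 modulo 4. *)
- move=> n4; have ev : ~~ odd m.+3 by lia.
  have -> : 8 = 2 * m.+3 by lia.
  apply: (@classifiedI _ _ [:: mapB m]) => //.
  + by case=> [|i] // _; apply: modelB.
  + by case=> [|i] [|j].
  + move=> M /classify[] []; try lia; by exists 0.
- move=> /m_in n12; have d3 : 3 %| m.+3 by lia.
  apply: (@classifiedI _ _ [:: mapC m]) => //.
  + by case=> [|i] // _; apply: modelC.
  + by case=> [|i] [|j].
  + move=> M /classify[] []; try lia; by exists 0.
- move=> /m_in n12 n4; have ev : ~~ odd m.+3 by lia.
  have FA := modelA ev n4; have FB := modelB ev.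
  apply: (@classifiedI _ _ [:: mapA m; mapB m]) => //.
  + by case=> [|[|i]].
  + case=> [|[|i]] [|[|j]] //= _ _.
    by case: (niso_lengths (k := m.+3) FA.2 FB.2) => //; rewrite !inE; lia.
  + move=> M /classify[] []; try lia; [by exists 0 | by exists 1].
- move=> /m_in n12; have ev : ~~ odd m.+3 by lia.
  have n4 : m.+3 != 4 by lia. have d4 : m.+3 %% 4 = 2 by lia.
  have FA := modelA ev n4; have FB := modelB ev; have FD := modelD d4.
  apply: (@classifiedI _ _ [:: mapA m; mapB m; mapD m]) => //.
  + by case=> [|[|[|i]]].
  + case=> [|[|[|i]]] [|[|[|j]]] //= _ _.
    * by case: (niso_lengths (k := m.+3) FA.2 FB.2) => //; rewrite !inE; lia.
    * by case: (niso_lengths (k := 4) FA.2 FD.2) => //; rewrite !inE; lia.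
    * by case: (niso_lengths (k := 4) FB.2 FD.2) => //; rewrite !inE; lia.
  + move=> M /classify[] []; try lia; [by exists 0 | by exists 1 | by exists 2].
(* [mapA] and [mapC] have the same face lengths and are told apart by [nisoAC]. Here [mapC] is
   listed before [mapB], unlike in [classify], whence the order of the indices at the end. *)
- move=> n12; have ev : ~~ odd m.+3 by lia.
  have n4 : m.+3 != 4 by lia. have d3 : 3 %| m.+3 by lia.
  have FA := modelA ev n4; have FB := modelB ev; have FC := modelC d3.
  apply: (@classifiedI _ _ [:: mapA m; mapC m; mapB m]) => //.
  + by case=> [|[|[|i]]].
  + case=> [|[|[|i]]] [|[|[|j]]] //= _ _.
    * by case: (nisoAC ev d3).
    * by case: (niso_lengths (k := m.+3) FA.2 FB.2) => //; rewrite !inE; lia.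
    * by case: (niso_lengths (k := m.+3) FC.2 FB.2) => //; rewrite !inE; lia.
  + move=> M /classify[] []; try lia; [by exists 0 | by exists 2 | by exists 1].
- move=> n12; have ev : ~~ odd m.+3 by lia.
  have n4 : m.+3 != 4 by lia. have d3 : 3 %| m.+3 by lia. have d4 : m.+3 %% 4 = 2 by lia.
  have FA := modelA ev n4; have FB := modelB ev; have FC := modelC d3; have FD := modelD d4.
  apply: (@classifiedI _ _ [:: mapA m; mapC m; mapB m; mapD m]) => //.
  + by case=> [|[|[|[|i]]]].
  + case=> [|[|[|[|i]]]] [|[|[|[|j]]]] //= _ _.
    * by case: (nisoAC ev d3).
    * by case: (niso_lengths (k := m.+3) FA.2 FB.2) => //; rewrite !inE; lia.
    * by case: (niso_lengths (k := 4) FA.2 FD.2) => //; rewrite !inE; lia.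
    * by case: (niso_lengths (k := m.+3) FC.2 FB.2) => //; rewrite !inE; lia.
    * by case: (niso_lengths (k := 4) FC.2 FD.2) => //; rewrite !inE; lia.
    * by case: (niso_lengths (k := 4) FB.2 FD.2) => //; rewrite !inE; lia.
  + move=> M /classify[] []; try lia; [by exists 0 | by exists 2 | by exists 1 | by exists 3].
Qed.
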